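(* Let $G = (V, E)$ be a planar graph without isolated vertices and such that $\Delta(G) \leq 8$. Then $G$ contains at least $|V|/1460$ reducible edges.
   Context: For a vertex $v$, $d(v)$ denotes its degree; an $8$-neighbor of $x$ is a neighbor of degree $8$. An edge $xy$ is called $x$-weak if $x$ has at most $8 - d(y) + [d(y) = 8]$ neighbors of degree $8$ (here $[d(y)=8]$ is $1$ if $d(y)=8$ and $0$ otherwise); $xy$ is weak if it is $x$-weak or $y$-weak. A butterfly is a subgraph $B \subseteq G$ of one of the following two forms. Form $B_1$: $V(B)$ consists of distinct vertices $x, y, z, v_1, v_2, v_3$; $E(B)$ consists of the edges $xy, xz, yv_1, yv_3, zv_1, zv_2$, and $xv_i$ for $i \in \{1,2,3\}$; and $d_G(y) = d_G(z) = 3$, $d_G(x) = 8$, $d_G(v_i) = 8$ for $i \in \{1,2,3\}$. Form $B_2$: $V(B)$ consists of distinct vertices $x, y, z, v_1, v_2, v_3, v_4$; $E(B)$ consists of the edges $xy, xz, yv_1, yv_4, zv_2, zv_3$, and $xv_i$ for $i \in \{1,2,3,4\}$; and $d_G(y) = d_G(z) = 3$, $d_G(x) = 8$, $d_G(v_i) = 8$ for $i \in \{1,2,3,4\}$. For such a butterfly, the edge $xy$ is called butterfly-like. An edge is called reducible if it is weak or butterfly-like. *)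

(* Defs.v *)
From HB Require Import structures.
From mathcomp Require Import all_boot all_order all_algebra.
From mathcomp Require Import all_classical all_reals all_analysis.
From mathcomp Require Import Rstruct Rstruct_topology.
Set Implicit Arguments. Unset Strict Implicit. Unset Printing Implicit Defensive.
Import Order.TTheory GRing.Theory Num.Theory.

Section Graphs.
Variable T : finType.
Variable e : rel T.

Definition deg (v : T) : nat := #|[set u | e v u]|.

Definition n8 (x : T) : nat := #|[set u | e x u && (deg u == 8)]|.

(* xy is x-weak: n8 x <= 8 - d(y) + [d(y)=8], written without truncated subtraction *)
Definition x_weak (x y : T) : bool :=
  e x y && (n8 x + deg y <= 8 + (deg y == 8))%N.

Definition weak (x y : T) : bool := x_weak x y || x_weak y x.

Definition butterfly1 (x y : T) : bool :=
  [exists z, exists v1, exists v2, exists v3,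
    [&& uniq [:: x; y; z; v1; v2; v3],
        e x y, e x z, e y v1, e y v3, e z v1, e z v2,
        e x v1, e x v2, e x v3,
        deg y == 3, deg z == 3, deg x == 8,
        deg v1 == 8, deg v2 == 8 & deg v3 == 8]].

Definition butterfly2 (x y : T) : bool :=
  [exists z, exists v1, exists v2, exists v3, exists v4,
    [&& uniq [:: x; y; z; v1; v2; v3; v4],
        e x y, e x z, e y v1, e y v4, e z v2, e z v3,
        e x v1, e x v2, e x v3, e x v4,
        deg y == 3, deg z == 3, deg x == 8,
        deg v1 == 8, deg v2 == 8, deg v3 == 8 & deg v4 == 8]].

(* the (unordered) edge {x,y} is butterfly-like: it is the edge xy of some butterfly
   (with either endpoint playing the role of the centre x) *)
Definition butterfly_like (x y : T) : bool :=
  [|| butterfly1 x y, butterfly2 x y, butterfly1 y x | butterfly2 y x].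

Definition reducible (x y : T) : bool := e x y && (weak x y || butterfly_like x y).

Definition reducible_edges : {set {set T}} :=
  [set E : {set T} | [exists x, exists y, (E == [set x; y]) && reducible x y]].

Local Open Scope classical_set_scope.
Local Open Scope ring_scope.
(* Planarity: a drawing in R^2 with distinct points for vertices and, for each edge,
   a simple arc (continuous, injective on [0,1]) joining its endpoints, whose interior
   avoids all vertices and the interiors of arcs of other edges. The arcs c x y and
   c y x both exist for an edge; only arcs of distinct edges are required disjoint. *)
Definition planar : Prop :=
  exists (p : T -> (Rdefinitions.R * Rdefinitions.R)%type)
           (c : T -> T -> Rdefinitions.R -> (Rdefinitions.R * Rdefinitions.R)%type),
    injective p /\
    forall x y, e x y ->
      [/\ {within [set t : Rdefinitions.R | 0 <= t <= 1], continuous (c x y)},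
          {in [pred t : Rdefinitions.R | 0 <= t <= 1] &, injective (c x y)},
          c x y 0 = p x /\ c x y 1 = p y,
          (forall t z, 0 < t < 1 -> c x y t <> p z) &
          (forall x' y', e x' y' ->
             ~~ (((x' == x) && (y' == y)) || ((x' == y) && (y' == x))) ->
             forall t s, 0 < t < 1 -> 0 < s < 1 -> c x y t <> c x' y' s)].
End Graphs.

(* Main.v *)
(* A plane drawing, sampled finely enough, rules out K5 and K33 minors by van Kampen's
   parity argument: vertex-disjoint edges stay apart, so mod 2 the number of times one
   curve turns around the endpoints of another satisfies a relation for every pair of
   disjoint edges, and these relations add up to 1 = 0. K5-minor-free graphs have at
   most 3n - 6 edges (Mader).
   Discharging the charges d(v) - 6 along the non-weak edges leaves every vertex away
   from the reducible edges with nonnegative charge, which is just short of a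
   contradiction. The missing linear surplus comes from three improvements of the bound
   3n - 6: 2-vertices can be deleted; a 3-vertex with nonadjacent neighbours can be
   contracted so as to create a new edge; and when two 3-vertices have the same
   neighbourhood, a triangle, that triangle splits the rest of the graph (no K33 minor)
   along an edge. An 8-vertex without surplus and far from the first two situations has
   two 3-neighbours whose neighbourhoods are triangles, hence equal by the absence of
   butterflies. *)
Require Import Defs.
From HB Require Import structures.
From Stdlib Require Import Btauto.
From mathcomp Require Import all_classical all_reals all_analysis.
From mathcomp Require Import Rstruct Rstruct_topology.
From mathcomp Require Import all_boot all_order all_algebra.
From mathcomp Require Import lra zify.
Set Implicit Arguments. Unset Strict Implicit. Unset Printing Implicit Defensive.
Import Order.TTheory GRing.Theory Num.Theory.
Import numFieldNormedType.Exports.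

(** * Parity of crossings in planar drawings *)

(** [planar] provides arcs only and no faces, so whatever a face argument would say about surplus
    has to appear as an extra term in the inequality [arcs e + 12 <= 6 * #|T|]. The discharging is
    deliberately incomplete: a vertex incident with a reducible edge, called bad below, may end with
    a deficit bounded by a constant. Comparing the discharged total with the strengthened edge
    bounds shows that every class of vertices with a surplus or a gain is at most a constant times
    as large as the set of bad vertices. The other good vertices have degree 3 or 8 and may end with
    charge zero; they are counted through their neighbours, which is possible because degrees are at
    most 8. A reducible edge has two ends, so a factor 730 for bad vertices becomes 1460 for
    edges. *)

Lemma addb_xorb a b : addb a b = xorb a b.
Proof. by case: a b => -[]. Qed.

Lemma addb_eq0 a b : a (+) b = false -> a = b.
Proof. by case: a b => -[]. Qed.

(** Addition of two equations mod 2; what remains is a Boolean identity for [btauto]. *)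
Lemma addb_sum2 x1 y1 x2 y2 z : x1 = y1 -> x2 = y2 ->
  z = (x1 (+) y1) (+) (x2 (+) y2) -> z = false.
Proof. by move=> -> -> ->; rewrite !addbb. Qed.

Section Cells.
Variable R : realDomainType.
Local Notation point := (R * R)%type.
Implicit Types (a b u v o : point) (P Q : seq point).
Definition same_sign4 (a b c d : R) : bool :=
  ([&& 0 < a, 0 < b, 0 < c & 0 < d] || [&& a < 0, b < 0, c < 0 & d < 0])%R.

(* The four differences lie strictly on one side of a coordinate axis, so passing from
   one to another cannot turn around the origin. *)
Definition good_cell (a a' b b' : point) : bool :=
  (same_sign4 (b.1 - a.1) (b'.1 - a.1) (b.1 - a'.1) (b'.1 - a'.1) ||
   same_sign4 (b.2 - a.2) (b'.2 - a.2) (b.2 - a'.2) (b'.2 - a'.2))%R.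

(** Ties in height are broken by the first coordinate, so distinct points are always comparable and
    no general position is assumed. *)
Definition upper a b : bool :=
  ((a.2 < b.2) || (a.2 == b.2) && (a.1 < b.1))%R.

Lemma upperC a b : a != b -> upper b a = ~~ upper a b.
Proof.
rewrite /upper -pair_eqE /pair_eq negb_and => ab.
case: (ltgtP a.2 b.2) => //= e2; case: (ltgtP a.1 b.1) => //= e1.
by move: ab; rewrite e1 e2 !eqxx.
Qed.

(* Whether the short move from u to v, as seen from o, crosses the horizontal
   ray leaving o to the right. *)
Definition crosses o u v : bool :=
  (upper o u (+) upper o v) && (o.1 < u.1)%R.

(** If the differences lie strictly to the right, the terms seen from [b] and [b'] vanish and those
    seen from [a] and [a'] are sums of [upper] values; to the left the roles are exchanged. If they
    lie strictly above or below, both sides are zero. *)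
Lemma good_cell_parity a a' b b' : good_cell a a' b b' ->
  crosses a b b' (+) crosses a' b b' (+) crosses b a a' (+) crosses b' a a' =
  upper a b (+) upper a' b (+) upper a b' (+) upper a' b'.
Proof.
rewrite /good_cell /same_sign4 !subr_gt0 !subr_lt0 /crosses /upper.
case/orP; case/orP => /and4P[h1 h2 h3 h4];
  rewrite ?h1 ?h2 ?h3 ?h4 ?(lt_gtF h1) ?(lt_gtF h2) ?(lt_gtF h3) ?(lt_gtF h4)
    ?(lt_eqF h1) ?(lt_eqF h2) ?(lt_eqF h3) ?(lt_eqF h4)
    ?(gt_eqF h1) ?(gt_eqF h2) ?(gt_eqF h3) ?(gt_eqF h4) ?andbT ?andbF ?orbF //=.
- by case: (ltgtP a.2 b.2); case: (ltgtP a.2 b'.2);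
  case: (ltgtP a'.2 b.2); case: (ltgtP a'.2 b'.2).
- by case: (ltgtP a.2 b.2); case: (ltgtP a.2 b'.2);
  case: (ltgtP a'.2 b.2); case: (ltgtP a'.2 b'.2).
Qed.

Fixpoint turns o u P : bool :=
  if P is v :: P' then crosses o u v (+) turns o v P' else false.

Fixpoint chain (step : point -> point -> Prop) u P : Prop :=
  if P is v :: P' then step u v /\ chain step v P' else True.

Lemma chain_sub (s1 s2 : point -> point -> Prop) u P :
  (forall a b, s1 a b -> s2 a b) -> chain s1 u P -> chain s2 u P.
Proof. by move=> s12; elim: P u => //= v P IH u [/s12 uv /IH]. Qed.

Lemma chain_cat s u P Q : chain s u P -> chain s (last u P) Q -> chain s u (P ++ Q).
Proof. by elim: P u => //= v P IH u [uv vP] Q'; split=> //; apply: IH. Qed.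

Lemma strip_parity (s : point -> point -> Prop) b b' u P :
  (forall a a', s a a' -> good_cell a a' b b') -> chain s u P ->
  crosses u b b' (+) crosses (last u P) b b' (+) turns b u P (+) turns b' u P =
  upper u b (+) upper (last u P) b (+) upper u b' (+) upper (last u P) b'.
Proof.
move=> sg; elim: P u => [|v P IH] u /=.
  by move=> _; apply: addb_eq0; rewrite !addb_xorb; btauto.
case=> /sg/good_cell_parity E /IH {}IH; apply: addb_eq0.
apply: addb_sum2 E IH _; rewrite !addb_xorb; btauto.
Qed.

(** The cell relations of a grid add up: an inner side belongs to two cells and cancels, so only the
    four outer sides and the four corners remain. *)
Lemma rectangle_parity (s t : point -> point -> Prop) u P v Q :
  (forall a a' b b', s a a' -> t b b' -> good_cell a a' b b') ->
  chain s u P -> chain t v Q ->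
  turns u v Q (+) turns (last u P) v Q (+) turns v u P (+) turns (last v Q) u P =
  upper u v (+) upper (last u P) v (+)
  upper u (last v Q) (+) upper (last u P) (last v Q).
Proof.
move=> st sP; elim: Q v => [|w Q IH] v /=.
  by move=> _; apply: addb_eq0; rewrite !addb_xorb; btauto.
case=> vw /IH {}IH; have E := strip_parity (fun a a' saa => st a a' v w saa vw) sP.
apply: addb_eq0; apply: addb_sum2 E IH _; rewrite !addb_xorb; btauto.
Qed.
End Cells.

(** * Van Kampen's parity obstruction for K5 and K33 *)

Section Obstructions.
Variables (R : realDomainType) (T : finType) (p : T -> (R * R)%type).
(** To be read as a short move along an edge with both ends in the given set. Sets of vertices
    rather than edges are used so that the obstruction applies to the bags of a minor. *)
Variable step : {set T} -> (R * R)%type -> (R * R)%type -> Prop.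
Hypothesis p_inj : injective p.
Hypothesis step_good : forall A B : {set T}, [disjoint A & B] ->
  forall a a' b b', step A a a' -> step B b b' -> good_cell a a' b b'.

Lemma square_parity (A B C D : {set T}) a b c d P Q :
  [disjoint A :|: B & C :|: D] ->
  a \in A -> b \in B -> c \in C -> d \in D ->
  chain (step (A :|: B)) (p a) P -> last (p a) P = p b ->
  chain (step (C :|: D)) (p c) Q -> last (p c) Q = p d ->
  turns (p a) (p c) Q (+) turns (p b) (p c) Q (+) turns (p c) (p a) P (+) turns (p d) (p a) P
  = upper (p a) (p c) (+) upper (p b) (p c) (+) upper (p a) (p d) (+) upper (p b) (p d).
Proof.
move=> dis aA bB cC dD sP lP sQ lQ.
by have := rectangle_parity (step_good dis) sP sQ; rewrite lP lQ.
Qed.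

Section Drawing.
Variables (n : nat) (edge : rel nat).
Variables (A : nat -> {set T}) (a : nat -> T) (L : nat -> nat -> seq (R * R)).
Hypothesis dA : forall i j, i < j < n -> [disjoint A i & A j].
Hypothesis aA : forall i, i < n -> a i \in A i.
Hypothesis hL : forall i j, i < n -> j < n -> edge i j ->
  chain (step (A i :|: A j)) (p (a i)) (L i j) /\ last (p (a i)) (L i j) = p (a j).

Lemma bags_disjoint i j : i < n -> j < n -> i != j -> [disjoint A i & A j].
Proof.
move=> i5 j5; rewrite neq_ltn => /orP[ij|ji]; first by apply: dA; rewrite ij.
by rewrite disjoint_sym dA // ji.
Qed.

Lemma drawing_upperC i j : i < n -> j < n -> i != j ->
  upper (p (a j)) (p (a i)) = ~~ upper (p (a i)) (p (a j)).
Proof.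
move=> i5 j5 ij; apply: upperC; apply: contraTneq isT => /p_inj aij.
by have := disjointFr (bags_disjoint i5 j5 ij) (aA i5); rewrite aij aA.
Qed.

Definition turns_around i k l := turns (p (a i)) (p (a k)) (L k l).
Definition upper_pair i j := upper (p (a i)) (p (a j)).

Lemma edges_parity i j k l : all (gtn n) [:: i; j; k; l] -> edge i j && edge k l ->
  uniq [:: i; j; k; l] ->
  turns_around i k l (+) turns_around j k l (+) turns_around k i j (+) turns_around l i j =
  upper_pair i k (+) upper_pair j k (+) upper_pair i l (+) upper_pair j l.
Proof.
case/and5P=> i5 j5 k5 l5 _ /andP[/(hL i5 j5)[cij lij] /(hL k5 l5)[ckl lkl]].
rewrite /= !inE !negb_or => /and4P[/and3P[_ ik il] /andP[jk jl] _ _].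
apply: (square_parity _ (aA i5) (aA j5) (aA k5) (aA l5) cij lij ckl lkl).
by rewrite -setI_eq0 setIUl !setIUr !setU_eq0 !setI_eq0 !bags_disjoint.
Qed.

End Drawing.

(* In the sum of the square relations over all pairs of disjoint edges, every
   [turns_around] occurs twice, while the right-hand sides add up to an odd number. *)
Lemma no_K5_drawing (A : nat -> {set T}) (a : nat -> T) (L : nat -> nat -> seq (R * R)) :
  (forall i j, i < j < 5 -> [disjoint A i & A j]) ->
  (forall i, i < 5 -> a i \in A i) ->
  (forall i j, i < 5 -> j < 5 -> i < j -> chain (step (A i :|: A j)) (p (a i)) (L i j)
     /\ last (p (a i)) (L i j) = p (a j)) -> False.
Proof.
move=> dA aA hL; have hC := drawing_upperC dA aA.
have hC' i j : i < 5 -> j < 5 -> i != j -> upper_pair a j i = ~~ upper_pair a i j := hC i j.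
have sq := edges_parity dA aA hL.
have F := congr2 addb (sq 0 1 2 3 isT isT isT)
    (congr2 addb (sq 0 1 2 4 isT isT isT)
    (congr2 addb (sq 0 1 3 4 isT isT isT)
    (congr2 addb (sq 0 2 1 3 isT isT isT)
    (congr2 addb (sq 0 2 1 4 isT isT isT)
    (congr2 addb (sq 0 2 3 4 isT isT isT)
    (congr2 addb (sq 0 3 1 2 isT isT isT)
    (congr2 addb (sq 0 3 1 4 isT isT isT)
    (congr2 addb (sq 0 3 2 4 isT isT isT)
    (congr2 addb (sq 0 4 1 2 isT isT isT)
    (congr2 addb (sq 0 4 1 3 isT isT isT)
    (congr2 addb (sq 0 4 2 3 isT isT isT)
    (congr2 addb (sq 1 2 3 4 isT isT isT)
    (congr2 addb (sq 1 3 2 4 isT isT isT)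
    (sq 1 4 2 3 isT isT isT)))))))))))))).
(* For p < q < r < s the three squares need 0, 1 and 2 reversals to put every [upper_pair] in
   increasing order. The five quadruples thus need 15, an odd number, while each unordered pair
   occurs six times and cancels. *)
move: F; rewrite ?(hC' 0 1) // ?(hC' 0 2) // ?(hC' 0 3) // ?(hC' 0 4) //
  ?(hC' 1 2) // ?(hC' 1 3) // ?(hC' 1 4) // ?(hC' 2 3) // ?(hC' 2 4) // ?(hC' 3 4) // => F.
suff : true = false by [].
apply: addb_sum2 F (erefl true) _; rewrite !addb_xorb; btauto.
Qed.

(** Over the 18 pairs of disjoint edges each [turns_around] again occurs twice. Pairs of vertices
    across the classes occur 4 times and pairs inside a class 6 times; ordering them takes 18 + 9
    reversals, an odd number. *)
Lemma no_K33_drawing (A : nat -> {set T}) (a : nat -> T) (L : nat -> nat -> seq (R * R)) :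
  (forall i j, i < j < 6 -> [disjoint A i & A j]) ->
  (forall i, i < 6 -> a i \in A i) ->
  (forall i j, i < 6 -> j < 6 -> (i < 3) && (2 < j) -> chain (step (A i :|: A j)) (p (a i)) (L i j)
     /\ last (p (a i)) (L i j) = p (a j)) -> False.
Proof.
move=> dA aA hL; have hC := drawing_upperC dA aA.
have hC' i j : i < 6 -> j < 6 -> i != j -> upper_pair a j i = ~~ upper_pair a i j := hC i j.
have sq := edges_parity dA aA hL.
have F := congr2 addb (sq 0 3 1 4 isT isT isT)
    (congr2 addb (sq 0 3 1 5 isT isT isT)
    (congr2 addb (sq 0 3 2 4 isT isT isT)
    (congr2 addb (sq 0 3 2 5 isT isT isT)
    (congr2 addb (sq 0 4 1 3 isT isT isT)
    (congr2 addb (sq 0 4 1 5 isT isT isT)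
    (congr2 addb (sq 0 4 2 3 isT isT isT)
    (congr2 addb (sq 0 4 2 5 isT isT isT)
    (congr2 addb (sq 0 5 1 3 isT isT isT)
    (congr2 addb (sq 0 5 1 4 isT isT isT)
    (congr2 addb (sq 0 5 2 3 isT isT isT)
    (congr2 addb (sq 0 5 2 4 isT isT isT)
    (congr2 addb (sq 1 3 2 4 isT isT isT)
    (congr2 addb (sq 1 3 2 5 isT isT isT)
    (congr2 addb (sq 1 4 2 3 isT isT isT)
    (congr2 addb (sq 1 4 2 5 isT isT isT)
    (congr2 addb (sq 1 5 2 3 isT isT isT)
    (sq 1 5 2 4 isT isT isT))))))))))))))))).
move: F; rewrite ?(hC' 0 1) // ?(hC' 0 2) // ?(hC' 0 3) // ?(hC' 0 4) //
  ?(hC' 0 5) // ?(hC' 1 2) // ?(hC' 1 3) // ?(hC' 1 4) // ?(hC' 1 5) // ?(hC' 2 3) //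
  ?(hC' 2 4) // ?(hC' 2 5) // ?(hC' 3 4) // ?(hC' 3 5) // ?(hC' 4 5) // => F.
suff : true = false by [].
apply: addb_sum2 F (erefl true) _; rewrite !addb_xorb; btauto.
Qed.

End Obstructions.

(** * Minors and the edge bound for K5-minor-free graphs *)

Section Minors.
Variable T : finType.
Implicit Types (r : rel T) (C D S : {set T}) (x y v : T).

Definition restr r C : rel T := fun u v => [&& u \in C, v \in C & r u v].

Definition conn r C : bool :=
  (C != set0) && [forall a in C, forall b in C, connect (restr r C) a b].

Definition linked r : rel {set T} := fun C D =>
  [disjoint C & D] && [exists a in C, exists b in D, r a b].

Definition K5_free r := forall B : seq {set T},
  size B = 5 -> all (conn r) B -> ~~ pairwise (linked r) B.

Definition K33_free r := forall X Y : seq {set T}, size X = 3 -> size Y = 3 ->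
  all (conn r) (X ++ Y) -> pairwise (fun A B : {set T} => [disjoint A & B]) (X ++ Y) ->
  ~~ allrel (linked r) X Y.

(** The vertex type is kept: vertices outside the image of [phi] become isolated. This is why the
    edge bound is stated for a set [S] carrying the edges. *)
Definition contract (phi : T -> T) r : rel T := fun s s' =>
  (s != s') && [exists v, exists v', [&& phi v == s, phi v' == s' & r v v']].

Lemma connP r C : reflect (C != set0 /\ {in C &, forall a b, connect (restr r C) a b}) (conn r C).
Proof.
apply: (iffP andP) => -[C0 H]; split=> //.
  by move=> a b aC bC; move/forall_inP/(_ a aC)/forall_inP/(_ b bC): H.
by apply/forall_inP => a aC; apply/forall_inP => b bC; apply: H.
Qed.

Lemma sub_conn r r' C : subrel r r' -> conn r C -> conn r' C.
Proof.
move=> rr /connP[C0 H]; apply/connP; split=> // a b aC bC.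
apply: connect_sub (H a b aC bC) => u v /and3P[uC vC ruv].
by apply: connect1; rewrite /restr uC vC rr.
Qed.

Lemma sub_linked r r' : subrel r r' -> subrel (linked r) (linked r').
Proof.
move=> rr C D /andP[dCD /exists_inP[a aC /exists_inP[b bD rab]]].
by rewrite /linked dCD; apply/exists_inP; exists a => //; apply/exists_inP; exists b => //; apply: rr.
Qed.

Lemma sub_K5_free r r' : subrel r r' -> K5_free r' -> K5_free r.
Proof.
move=> rr H B sB cB; apply: contra (H B sB _).
  by apply: sub_pairwise; apply: sub_linked.
by apply: sub_all cB => C; apply: sub_conn.
Qed.

Lemma conn1 r x : conn r [set x].
Proof.
apply/connP; split; first by apply/set0Pn; exists x; rewrite set11.
by move=> a b /set1P-> /set1P->.
Qed.

Lemma conn2 r x y : symmetric r -> r x y -> conn r [set x; y].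
Proof.
move=> sr rxy; apply/connP; split; first by apply/set0Pn; exists x; rewrite set21.
have xy : connect (restr r [set x; y]) x y by apply: connect1; rewrite /restr set21 set22.
have yx : connect (restr r [set x; y]) y x by apply: connect1; rewrite /restr set21 set22 sr.
by move=> a b /set2P[]-> /set2P[]->.
Qed.

(** * Contraction preserves the absence of a K5 minor *)

Section Contraction.
Variables (phi : T -> T) (r : rel T).
Hypothesis sr : symmetric r.
Hypothesis phi_step : forall v, phi v = v \/ r v (phi v).
Hypothesis phi_idem : forall v, phi (phi v) = phi v.

Lemma contract_sym : symmetric (contract phi r).
Proof.
have H s s' : contract phi r s s' -> contract phi r s' s.
  case/andP=> ss' /existsP[v /existsP[v' /and3P[a b c]]].
  by rewrite /contract eq_sym ss'; apply/existsP; exists v'; apply/existsP; exists v; rewrite a b sr.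
by move=> s s'; apply/idP/idP => /H.
Qed.

(** The inclusion excludes the singleton of a vertex outside the image, which is connected but has
    an empty preimage. *)
Lemma contract_conn C : C \subset phi @: setT -> conn (contract phi r) C -> conn r (phi @^-1: C).
Proof.
move=> Cphi /connP[/set0Pn[s sC] H]; apply/connP; split.
  have /imsetP[v _ sv] := subsetP Cphi s sC.
  by apply/set0Pn; exists v; rewrite inE -sv.
set C' := phi @^-1: C; have step v : phi v \in C ->
    connect (restr r C') v (phi v) /\ connect (restr r C') (phi v) v.
  move=> vC; case: (phi_step v) => [->|rv]; first by [].
  by split; apply: connect1; rewrite /restr !inE phi_idem vC // sr.
move=> a b; rewrite !inE => aC bC.
apply: connect_trans (step a aC).1 _; apply: connect_trans (step b bC).2.
have {}H := H _ _ aC bC; rewrite -[X in connect _ X](phi_idem a).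
have K u v : u \in C -> v \in C -> contract phi r u v -> connect (restr r C') u v.
  move=> uC vC /andP[_ /existsP[w /existsP[w' /and3P[/eqP wu /eqP w'v rww]]]].
  rewrite -wu in uC *; rewrite -w'v in vC *.
  apply: connect_trans (step w uC).2 _; apply: connect_trans (step w' vC).1.
  by apply: connect1; rewrite /restr !inE uC vC.
rewrite phi_idem; apply: connect_sub H => u v /and3P[uC vC].
exact: K.
Qed.

Lemma contract_K5_free : K5_free r -> K5_free (contract phi r).
Proof.
move=> H B sB cB; apply/negP => lB.
(* A bag is linked to another bag, so it contains a vertex of the image; being connected, it cannot
   contain an isolated vertex besides. *)
have imC C : C \in B -> C \subset phi @: setT.
  move=> CB.
  have [D DB CD] : exists2 D, D \in B & linked (contract phi r) C D || linked (contract phi r) D C.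
    move: lB CB sB; clear; case: B => [|B1 [|B2 B]] //= /andP[/andP[l12 l1] /andP[l2 _]].
    rewrite !inE => /or3P[/eqP->|/eqP->|CB] _.
    - by exists B2; rewrite ?inE ?eqxx ?orbT ?l12.
    - by exists B1; rewrite ?inE ?eqxx ?orbT ?l12 ?orbT.
    - by exists B1; rewrite ?inE ?eqxx ?orbT //; move/allP: l1 => /(_ C CB) ->; rewrite orbT.
  have /connP[_ cC] := allP cB C CB.
  have [c cC0 [v cv]] : exists2 c, c \in C & exists v, phi v = c.
    case/orP: CD => /andP[_ /exists_inP[a aC /exists_inP[b bD]]]
      /andP[_ /existsP[v /existsP[v' /and3P[/eqP va /eqP vb _]]]].
      by exists a => //; exists v.
    by exists b => //; exists v'.
  apply/subsetP => d dC; case/connectP: (cC _ _ dC cC0) => -[|u p] /=.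
    by move=> _ dc; rewrite -dc -cv imset_f.
  case/andP=> /and3P[_ _ /andP[_ /existsP[w /existsP[w' /and3P[/eqP wd _ _]]]]] _ _.
  by rewrite -wd imset_f.
apply: (negP (H (map (fun C => phi @^-1: C) B) _ _)).
- by rewrite size_map.
- rewrite all_map; apply/allP => C CB /=; apply: contract_conn; first exact: imC.
  exact: (allP cB).
- rewrite pairwise_map; apply: sub_pairwise lB => C D /andP[dCD /exists_inP[a aC /exists_inP[b bD]]].
  case/andP=> ab /existsP[v /existsP[v' /and3P[/eqP va /eqP vb rvv]]].
  rewrite /= /linked -[[disjoint _ & _]]setI_eq0 -preimsetI; move: dCD; rewrite -setI_eq0 => /eqP->.
  rewrite preimset0 eqxx /=; apply/exists_inP; exists v; first by rewrite inE va.
  by apply/exists_inP; exists v' => //; rewrite inE vb.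
Qed.

End Contraction.

(** Ordered pairs are counted, so this is twice the number of edges, and [arcs r + 12 <= 6 * #|S|]
    is the bound 3n - 6. *)
Definition arcs r : nat := #|[set p : T * T | r p.1 p.2]|.

Lemma card_rel r : #|[set p : T * T | r p.1 p.2]| = \sum_u #|[set v | r u v]|.
Proof.
rewrite -sum1_card (eq_bigl (fun p : T * T => r p.1 p.2)); last by move=> p; rewrite inE.
rewrite -(pair_big_dep xpredT r (fun _ _ => 1)) /=.
by apply: eq_bigr => u _; rewrite -sum1_card; apply: eq_bigl => v; rewrite inE.
Qed.

Lemma arcs_sum r : arcs r = \sum_u deg r u.
Proof. exact: card_rel. Qed.

Lemma arcs_delete r (Y : {set T}) : symmetric r ->
  arcs r <= arcs (restr r (~: Y)) + 2 * \sum_(y in Y) deg r y.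
Proof.
move=> sr; pose r1 u v := (u \in Y) && r u v.
have c1 : #|[set p : T * T | r1 p.1 p.2]| = \sum_(y in Y) deg r y.
  rewrite card_rel [RHS]big_mkcond; apply: eq_bigr => u _; rewrite /r1.
  by case: (u \in Y) => //=; apply: eq_card0 => v; rewrite inE.
pose swap (p : T * T) := (p.2, p.1).
have c2 : #|swap @^-1: [set p : T * T | r1 p.1 p.2]| = \sum_(y in Y) deg r y.
  rewrite -c1 on_card_preimset //; exists swap => -[u v] //.
rewrite mul2n -addnn -{1}c1 -c2.
have H : [set p : T * T | r p.1 p.2] \subset [set p | restr r (~: Y) p.1 p.2] :|:
   ([set p : T * T | r1 p.1 p.2] :|: swap @^-1: [set p : T * T | r1 p.1 p.2]).
  apply/subsetP => -[u v]; rewrite !inE /= /restr !inE /r1 /= (sr v u) => ->.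
  by case: (u \in Y); case: (v \in Y).
apply: leq_trans (subset_leq_card H) _.
apply: leq_trans (leq_card_setU _ _) _; rewrite leq_add2l.
exact: leq_card_setU.
Qed.

(** What is lost is xy itself and, for each common neighbour, one of its two edges to x and y. The
    edges from [y] to the set [W] are moved to [x]. *)
Lemma arcs_contract r x y : symmetric r -> irreflexive r -> r x y ->
  arcs r <= arcs (contract (fun v => if v == y then x else v) r) + 2
    + 2 * #|[set w | r x w && r y w]|.
Proof.
move=> sr ir rxy; set phi := fun v => _; set r' := contract phi r.
have xy : x != y by apply: contraTneq rxy => ->; rewrite ir.
have := arcs_delete [set y] sr; rewrite big_set1 => H.
pose W := [set w | [&& r y w, ~~ r x w & w != x]].
have degy : deg r y <= #|W| + 1 + #|[set w | r x w && r y w]|.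
  have D : [set w | r y w] \subset W :|: [set x] :|: [set w | r x w && r y w].
    apply/subsetP => w; rewrite !inE => ->; by case: (r x w); case: (w == x).
  apply: leq_trans (subset_leq_card D) _; apply: leq_trans (leq_card_setU _ _) _.
  by rewrite leq_add2r; apply: leq_trans (leq_card_setU _ _) _; rewrite cards1.
set A := [set p : T * T | restr r (~: [set y]) p.1 p.2].
suff : #|A| + 2 * #|W| <= arcs r'.
  have -> : #|A| = arcs (restr r (~: [set y])) by [].
  move: H degy; rewrite /r'; lia.
have rW w : w \in W -> r' x w.
  rewrite inE => /and3P[ryw _ wx]; rewrite /r' /contract eq_sym wx.
  have wy : w != y by apply: contraTneq ryw => ->; rewrite ir.
  by apply/existsP; exists y; apply/existsP; exists w; rewrite /phi (negPf wy) !eqxx.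
have sr' : symmetric r' by apply: contract_sym.
have cX : #|setX [set x] W| = #|W| by rewrite cardsX cards1 mul1n.
have cX' : #|setX W [set x]| = #|W| by rewrite cardsX cards1 muln1.
rewrite mul2n -addnn -{1}cX -{1}cX'.
rewrite -(cardsUI (setX _ _)) (_ : setX [set x] W :&: setX W [set x] = set0); last first.
  apply/setP => -[u v]; rewrite !inE /=; case: (u =P x) => //= ->.
  by rewrite !andbF.
rewrite cards0 addn0 -cardsUI (_ : A :&: _ = set0) ?cards0 ?addn0; last first.
  apply/setP => -[u v]; rewrite !inE /= /restr !inE.
  case: (u =P x) => [->|_] /=; first by case: (r x v) => //=; rewrite ?andbF // (eq_sym x) rxy.
  by case: (v =P x) => [->|_] /=; rewrite ?andbF // (sr u x) andbT; case: (r x u); rewrite ?andbF.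
apply/subset_leq_card/subsetP => -[u v] /setUP[|/setUP[]].
- rewrite !inE /restr !inE => /and3P[uy vy ruv].
  rewrite /r' /contract; have -> : u != v by apply: contraTneq ruv => ->; rewrite ir.
  apply/existsP; exists u; apply/existsP; exists v.
  by rewrite /phi (negPf uy) (negPf vy) !eqxx.
- by case/setXP => /set1P-> vW; rewrite inE rW.
- by case/setXP => uW /set1P->; rewrite inE /= sr' rW.
Qed.

(** * K5 minors around a vertex of small degree *)

Lemma linked1 r x (B : {set T}) : x \notin B -> [exists b in B, r x b] -> linked r [set x] B.
Proof.
by move=> xB rxB; rewrite /linked disjoints1 xB; apply/exists_inP; exists x; rewrite ?set11.
Qed.

Lemma linked11 r x y : x != y -> r x y -> linked r [set x] [set y].
Proof. by move=> xy rxy; apply: linked1; rewrite ?inE //; apply/exists_inP; exists y; rewrite ?set11. Qed.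

Lemma K5_star r v k l m (D : {set T}) : conn r D -> uniq [:: v; k; l; m] ->
  pairwise r [:: v; k; l; m] -> all (fun x => (x \notin D) && [exists b in D, r x b]) [:: v; k; l; m] ->
  ~ K5_free r.
Proof.
move=> cD U P A /(_ [:: [set v]; [set k]; [set l]; [set m]; D] erefl) /=.
rewrite !conn1 cD => /(_ isT)/negP; apply.
move: U P A; rewrite /= !inE !negb_or !andbT => /and3P[/and3P[vk vl vm] /andP[kl km] lm].
case/and3P=> /and3P[rvk rvl rvm] /andP[rkl rkm] rlm
  /and4P[/andP[vD rv] /andP[kD rk] /andP[lD rl] /andP[mD rm]].
by rewrite !linked11 ?linked1.
Qed.

Lemma K5_wheel r v i j k l m : symmetric r -> uniq [:: v; i; j; k; l; m] ->
  all (r v) [:: i; j; k; l; m] -> r i j -> pairwise r [:: k; l; m] ->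
  all (fun x => r i x || r j x) [:: k; l; m] -> ~ K5_free r.
Proof.
move=> sr; rewrite -[X in uniq X]/([:: v] ++ [:: i; j] ++ [:: k; l; m]) uniq_catCA.
rewrite -[[:: v] ++ _]/[:: v; k; l; m] cat_uniq => /and3P[_ /hasPn dis U] V rij P A.
apply: (@K5_star r v k l m [set i; j]) => //; first exact: conn2.
  by move: V P => /= /and5P[_ _ -> -> /andP[-> _]] ->.
apply/allP => x xs; apply/andP; split; first by have := dis x xs; rewrite !inE.
apply/existsP; move: xs; rewrite inE => /orP[/eqP->|xs].
  by exists i; move: V => /= /andP[->]; rewrite set21.
by case/orP: (allP A x xs) => rx; [exists i|exists j]; rewrite sr rx ?set21 ?set22.
Qed.

(* Five such neighbours span a K5 minus a matching, in which some edge can be contracted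
   to leave a K4; together with v this is a K5. *)
Lemma K5_small_degree r v : symmetric r -> irreflexive r ->
  4 <= deg r v <= 5 -> (forall w, r v w -> 3 <= #|[set u | r v u && r w u]|) ->
  ~ K5_free r.
Proof.
move=> sr ir dv com; set N := enum [set u | r v u].
have rN u : (u \in N) = r v u by rewrite mem_enum inE.
have cN w : w \in N -> 3 <= count (r w) N.
  rewrite rN => /com; rewrite -size_filter.
  have /card_uniqP <- : uniq (filter (r w) N) by rewrite filter_uniq // enum_uniq.
  by rewrite (eq_card (B := [set u | r v u && r w u])) // => u; rewrite mem_filter rN inE andbC.
have UN : uniq (v :: N) by rewrite /= enum_uniq rN ir.
have vN : all (r v) N by apply/allP => u; rewrite rN.
have sN : 4 <= size N <= 5 by rewrite -cardE.
clear rN; move: N sN cN UN vN => N.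
case: N => [|a [|b [|c [|d [|f [|g N]]]]]] // _ cN U V.
  have ca := cN a; have cb := cN b; have cc := cN c; have cd := cN d; clear cN.
  move: ca cb cc cd; rewrite !inE !eqxx !orbT /= !ir !addn0 !add0n.
  rewrite (sr b a) (sr c a) (sr d a) (sr c b) (sr d b) (sr d c).
  move=> /(_ isT) ca /(_ isT) cb /(_ isT) cc /(_ isT) cd.
  apply: (@K5_star r v a b c [set d]); first exact: conn1.
  - by apply: subseq_uniq U; rewrite /= !eqxx.
  - move: V ca cb cc cd => /= /and5P[-> -> -> _ _].
    by case: (r a b); case: (r a c); case: (r a d); case: (r b c); case: (r b d); case: (r c d).
  apply/allP => x xs; apply/andP; split.
    move: U; rewrite -[[:: v; a; b; c; d]]/(rcons [:: v; a; b; c] d) rcons_uniq => /andP[+ _].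
    by apply: contra; rewrite inE => /eqP<-.
  apply/exists_inP; exists d; rewrite ?set11 //.
  move: V ca cb cc cd => /= /and5P[_ _ _ rvd _]; move: xs; rewrite !inE => /or4P[]/eqP-> //;
  by case: (r a b); case: (r a c); case: (r a d); case: (r b c); case: (r b d); case: (r c d).
have ca := cN a; have cb := cN b; have cc := cN c; have cd := cN d; have cf := cN f; clear cN.
move: ca cb cc cd cf; rewrite !inE !eqxx !orbT /= !ir !addn0 !add0n.
rewrite (sr b a) (sr c a) (sr d a) (sr c b) (sr d b) (sr d c) (sr f a) (sr f b) (sr f c) (sr f d).
move=> /(_ isT) ca /(_ isT) cb /(_ isT) cc /(_ isT) cd /(_ isT) cf.
have wheel i j k l m : perm_eq [:: a; b; c; d; f] [:: i; j; k; l; m] ->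
    [&& r i j, pairwise r [:: k; l; m] & all (fun x => r i x || r j x) [:: k; l; m]] -> ~ K5_free r.
  move=> pe /and3P[rij P A]; apply: (@K5_wheel r v i j k l m) => //.
    by move: U; rewrite -[[:: v, _ & _]]cat1s -[[:: v, i & _]]cat1s !cat_uniq
      (perm_uniq pe) (eq_has_r (perm_mem pe)).
  by rewrite -(perm_all _ pe).
(* Each of the five neighbours misses at most one other. The ten candidates for the contracted edge
   are tried in turn; the final case analysis shows that not all of them fail. *)
have [C|C1] := boolP [&& r a b, r c d, r c f, r d f, (r a c || r b c), (r a d || r b d) & (r a f || r b f)].
  apply: (wheel a b c d f); first by clear; apply/permP => P /=; lia.
  by move: C; rewrite /= !andbT;
    do 3?[case/andP=> ->] => /and4P[-> -> -> ->].
have [C|C2] := boolP [&& r a c, r b d, r b f, r d f, (r a b || r b c), (r a d || r c d) & (r a f || r c f)].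
  apply: (wheel a c b d f); first by clear; apply/permP => P /=; lia.
  by move: C; rewrite /= (sr c b) !andbT;
    do 3?[case/andP=> ->] => /and4P[-> -> -> ->].
have [C|C3] := boolP [&& r a d, r b c, r b f, r c f, (r a b || r b d), (r a c || r c d) & (r a f || r d f)].
  apply: (wheel a d b c f); first by clear; apply/permP => P /=; lia.
  by move: C; rewrite /= (sr d b) (sr d c) !andbT;
    do 3?[case/andP=> ->] => /and4P[-> -> -> ->].
have [C|C4] := boolP [&& r a f, r b c, r b d, r c d, (r a b || r b f), (r a c || r c f) & (r a d || r d f)].
  apply: (wheel a f b c d); first by clear; apply/permP => P /=; lia.
  by move: C; rewrite /= (sr f b) (sr f c) (sr f d) !andbT;
    do 3?[case/andP=> ->] => /and4P[-> -> -> ->].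
have [C|C5] := boolP [&& r b c, r a d, r a f, r d f, (r a b || r a c), (r b d || r c d) & (r b f || r c f)].
  apply: (wheel b c a d f); first by clear; apply/permP => P /=; lia.
  by move: C; rewrite /= (sr b a) (sr c a) !andbT;
    do 3?[case/andP=> ->] => /and4P[-> -> -> ->].
have [C|C6] := boolP [&& r b d, r a c, r a f, r c f, (r a b || r a d), (r b c || r c d) & (r b f || r d f)].
  apply: (wheel b d a c f); first by clear; apply/permP => P /=; lia.
  by move: C; rewrite /= (sr b a) (sr d a) (sr d c) !andbT;
    do 3?[case/andP=> ->] => /and4P[-> -> -> ->].
have [C|C7] := boolP [&& r b f, r a c, r a d, r c d, (r a b || r a f), (r b c || r c f) & (r b d || r d f)].
  apply: (wheel b f a c d); first by clear; apply/permP => P /=; lia.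
  by move: C; rewrite /= (sr b a) (sr f a) (sr f c) (sr f d) !andbT;
    do 3?[case/andP=> ->] => /and4P[-> -> -> ->].
have [C|C8] := boolP [&& r c d, r a b, r a f, r b f, (r a c || r a d), (r b c || r b d) & (r c f || r d f)].
  apply: (wheel c d a b f); first by clear; apply/permP => P /=; lia.
  by move: C; rewrite /= (sr c a) (sr c b) (sr d a) (sr d b) !andbT;
    do 3?[case/andP=> ->] => /and4P[-> -> -> ->].
have [C|C9] := boolP [&& r c f, r a b, r a d, r b d, (r a c || r a f), (r b c || r b f) & (r c d || r d f)].
  apply: (wheel c f a b d); first by clear; apply/permP => P /=; lia.
  by move: C; rewrite /= (sr c a) (sr c b) (sr f a) (sr f b) (sr f d) !andbT;
    do 3?[case/andP=> ->] => /and4P[-> -> -> ->].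
have [C|C10] := boolP [&& r d f, r a b, r a c, r b c, (r a d || r a f), (r b d || r b f) & (r c d || r c f)].
  apply: (wheel d f a b c); first by clear; apply/permP => P /=; lia.
  by move: C; rewrite /= (sr d a) (sr d b) (sr d c) (sr f a) (sr f b) (sr f c) !andbT;
    do 3?[case/andP=> ->] => /and4P[-> -> -> ->].
move: ca cb cc cd cf C1 C2 C3 C4 C5 C6 C7 C8 C9 C10.
clear; case: (r a b); case: (r a c); case: (r a d); case: (r a f) => //;
 case: (r b c); case: (r b d); case: (r b f) => //; by case: (r c d); case: (r c f); case: (r d f).
Qed.

Lemma restr_sym r C : symmetric r -> symmetric (restr r C).
Proof. by move=> sr u v; rewrite /restr sr andbCA. Qed.

Lemma restr_irr r C : irreflexive r -> irreflexive (restr r C).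
Proof. by move=> ir u; rewrite /restr ir !andbF. Qed.

Lemma restr_sub r C : subrel (restr r C) r.
Proof. by move=> u v /and3P[]. Qed.

Lemma arcs_bound r S : symmetric r -> irreflexive r -> (forall u v, r u v -> u \in S) ->
  arcs r <= #|S| * #|S|.-1.
Proof.
move=> sr ir rS; rewrite arcs_sum (bigID (mem S)) /= [X in _ + X]big1 ?addn0 => [|u uS]; last first.
  by apply: eq_card0 => v; rewrite inE; apply: contraNF uS => /rS.
rewrite -sum_nat_const; apply: leq_sum => u uS.
rewrite (cardsD1 u S) uS /=; apply/subset_leq_card/subsetP => v.
rewrite !inE => ruv; rewrite (rS v u) ?andbT 1?sr //.
by apply: contraTneq ruv => ->; rewrite ir.
Qed.

(** One vertex accounts for 6 arcs in the bound. In a minimal counterexample, deleting a vertex or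
    contracting an edge therefore loses more than 6 arcs, so degrees are at least 4 and adjacent
    vertices have at least 3 common neighbours. A vertex of degree at most 5 then gives a K5. *)
Theorem K5_free_arcs r S : symmetric r -> irreflexive r -> (forall u v, r u v -> u \in S) ->
  K5_free r -> 3 <= #|S| -> arcs r + 12 <= 6 * #|S|.
Proof.
(* Lexicographic induction on [#|S|], then [arcs r], which is at most [#|{: T * T}|]. *)
have [n] := ubnP (#|S| * #|{: T * T}|.+1 + arcs r); elim: n r S => // n IH r S hn sr ir rS fr S3.
have [S4|S3'] := ltnP 3 #|S|; last first.
  have E : #|S| = 3 by apply/eqP; rewrite eqn_leq S3' S3.
  by have := arcs_bound sr ir rS; rewrite E; lia.
have IHS r' v : v \in S -> symmetric r' -> irreflexive r' -> (forall u w, r' u w -> u \in S :\ v) ->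
    K5_free r' -> arcs r' + 18 <= 6 * #|S|.
  move=> vS sr' ir' rS' fr'; have Sv : #|S| = #|S :\ v|.+1 by rewrite (cardsD1 v S) vS.
  suff: arcs r' + 12 <= 6 * #|S :\ v| by lia.
  apply: IH => //; last by rewrite -ltnS -Sv.
  rewrite ltnS in hn; apply: leq_trans hn; rewrite Sv mulSn.
  have : arcs r' <= #|{: T * T}| := max_card _.
  by move: (_ * _) => c; lia.
rewrite leqNgt; apply/negP => big.
have /set0Pn[[x y]] : [set p : T * T | r p.1 p.2] != set0.
  by rewrite -card_gt0 -/(arcs r); lia.
rewrite inE /= => rxy.
(* Deleting a single edge, two arcs, already restores the bound. This caps the average degree below
   6. *)
have tight : arcs r + 12 <= 6 * #|S| + 2.
  pose r1 u v := [&& r u v, (u, v) != (x, y) & (u, v) != (y, x)].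
  have sr1 : symmetric r1.
    by move=> u v; rewrite /r1 sr !xpair_eqE ![(v == _) && _]andbC [X in _ && X]andbC.
  have E : arcs r = (arcs r1).+2.
    rewrite /arcs (cardsD1 (x, y)) inE /= rxy (cardsD1 (y, x)) !inE /= sr rxy xpair_eqE.
    rewrite (_ : y == x = false) ?add1n; last by apply: contraTF rxy => /eqP->; rewrite ir.
    congr _.+2; apply: eq_card => -[u v]; rewrite !inE /=.
    by rewrite /r1; case: (r u v); rewrite ?andbF ?andbT // andbC.
  suff: arcs r1 + 12 <= 6 * #|S| by rewrite E; lia.
  apply: IH => //.
  - by move: hn; rewrite E; lia.
  - by move=> u; rewrite /r1 ir.
  - by move=> u v /and3P[/rS].
  - by apply: sub_K5_free fr => u v /and3P[].
have low v : v \in S -> 4 <= deg r v.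
  move=> vS; rewrite ltnNge; apply/negP => dv.
  have := arcs_delete [set v] sr; rewrite big_set1 => H.
  suff: arcs (restr r (~: [set v])) + 18 <= 6 * #|S| by lia.
  apply: (IHS _ v) => //; [exact: restr_sym | exact: restr_irr | | ].
    by move=> u w; rewrite /restr !inE => /and3P[-> _ /rS].
  exact: sub_K5_free (@restr_sub r _) fr.
have com u v : r u v -> 3 <= #|[set w | r u w && r v w]|.
  move=> ruv; rewrite ltnNge; apply/negP => cuv.
  have uv : u != v by apply: contraTneq ruv => ->; rewrite ir.
  have := arcs_contract sr ir ruv; set phi := fun w => _; set r' := contract phi r => H.
  suff: arcs r' + 18 <= 6 * #|S| by lia.
  have phi1 w : phi w = w \/ r w (phi w).
    by rewrite /phi; case: eqP => [->|_]; [right; rewrite sr | left].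
  have phi2 w : phi (phi w) = phi w.
    by rewrite /phi; case: (w =P v) => [_|/eqP/negPf->//]; rewrite (negPf uv).
  apply: (IHS _ v); first by apply: (rS v u); rewrite sr.
  - exact: contract_sym.
  - by move=> w; rewrite /r' /contract eqxx.
  - move=> w w' /andP[_ /existsP[z /existsP[z' /and3P[/eqP<- _ /rS zS]]]].
    by rewrite !inE /phi; case: (z =P v) => [_|/eqP->//]; rewrite uv (rS u v).
  - exact: contract_K5_free.
have [v vS dv] : exists2 v, v \in S & deg r v <= 5.
  apply/exists_inP; apply: contraT; rewrite negb_exists_in => /forall_inP H.
  have : 6 * #|S| <= arcs r; last by lia.
  rewrite arcs_sum mulnC -sum_nat_const [leqRHS](bigID (mem S)) /=.
  by apply: leq_trans (leq_addr _ _); apply: leq_sum => v /H; rewrite ltnNge.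
by apply: (K5_small_degree sr ir (v := v)) fr => //; [rewrite low|move=> w; exact: com].
Qed.
End Minors.

(** * Planar graphs have neither a K5 nor a K33 minor *)

Section Cells.
Variable R : realType.
Local Notation point := (R * R)%type.

Local Open Scope classical_set_scope.
Local Open Scope ring_scope.

Let I : set R := [set t : R | 0 <= t <= 1].

Lemma same_sign_near (u v : R -> R) (s0 t0 : R) :
  I s0 -> I t0 -> {within I, continuous u} -> {within I, continuous v} ->
  u s0 != v t0 ->
  exists2 d : R, 0 < d & forall s s' t t', I s -> I s' -> I t -> I t' ->
   `|s0 - s| < d -> `|s0 - s'| < d -> `|t0 - t| < d -> `|t0 - t'| < d ->
   same_sign4 (v t - u s) (v t' - u s) (v t - u s') (v t' - u s').
Proof.
move=> Is0 It0 cu cv uv.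
(* If each function moves by less than half the gap, the difference keeps its sign. *)
have e0 : 0 < `|u s0 - v t0| / 2 by rewrite divr_gt0 ?normr_gt0 ?subr_eq0.
have mod (w : R -> R) x : I x -> {within I, continuous w} ->
  exists2 d : R, 0 < d & forall y, I y -> `|x - y| < d -> `|w x - w y| < `|u s0 - v t0| / 2.
  move=> Ix /(@subspace_continuousP _ I _ w)/(_ x Ix) cw.
  have W := (@cvgrPdist_lt _ R^o _ _ _ w (w x)).1 cw _ e0.
  have [d /= d0 H] := (nbhs_ballP x _).1 (W _).
  by exists d => // y Iy xy; apply: H.
have [d1 d10 H1] := mod u s0 Is0 cu.
have [d2 d20 H2] := mod v t0 It0 cv.
exists (Num.min d1 d2); first by rewrite lt_min d10.
move=> s s' t t' Is Is' It It'; rewrite !lt_min => /andP[/H1 a _] /andP[/H1 b _]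
  /andP[_ /H2 c] /andP[_ /H2 d].
move: (a Is) (b Is') (c It) (d It') uv; rewrite /same_sign4.
clear; move: (u s0) (v t0) (u s) (u s') (v t) (v t') => p q w x y z.
rewrite !ltr_norml => /andP[a1 a2] /andP[b1 b2] /andP[c1 c2] /andP[d1 d2].
rewrite neq_lt => /orP[pq|pq].
  have E : `|p - q| = q - p by rewrite distrC ger0_norm // subr_ge0 ltW.
  rewrite E in a1 a2 b1 b2 c1 c2 d1 d2.
  by apply/orP; left; apply/and4P; split; lra.
have E : `|p - q| = p - q by rewrite ger0_norm // subr_ge0 ltW.
rewrite E in a1 a2 b1 b2 c1 c2 d1 d2.
by apply/orP; right; apply/and4P; split; lra.
Qed.

(** At any two parameters the points differ in some coordinate, and by continuity this coordinate
    keeps separating them nearby. Compactness of the square of parameters yields a uniform mesh. *)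
Lemma good_cells (f g : R -> point) :
  {within I, continuous f} -> {within I, continuous g} ->
  (forall s t, I s -> I t -> f s <> g t) ->
  \forall N \near \oo, forall s s' t t', I s -> I s' -> I t -> I t' ->
    `|s - s'| <= N.+1%:R^-1 -> `|t - t'| <= N.+1%:R^-1 ->
    good_cell (f s) (f s') (g t) (g t').
Proof.
move=> cf cg dfg.
have cI : compact (I `*` I).
  have -> : I = `[0, 1]%classic by apply/seteqP; split=> x /=; rewrite in_itv.
  by apply: compact_setX; exact: segment_compact.
pose P (N : nat) (x : R * R) := I x.1 -> I x.2 -> forall s' t', I s' -> I t' ->
    `|x.1 - s'| <= N.+1%:R^-1 -> `|x.2 - t'| <= N.+1%:R^-1 ->
    good_cell (f x.1) (f s') (g x.2) (g t').
suff H : \forall N \near \oo, (I `*` I) `<=` P N.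
  apply: filterS H => N H s s' t t' Is Is' It It' ss tt.
  by have := H (s, t) (conj Is It) Is It s' t' Is' It' ss tt.
move/compact_near_coveringP: cI; apply.
move=> [s0 t0] [/= Is0 It0].
have [d d0 Hd] : exists2 d : R, 0 < d & forall s s' t t', I s -> I s' -> I t -> I t' ->
   `|s0 - s| < d -> `|s0 - s'| < d -> `|t0 - t| < d -> `|t0 - t'| < d ->
   good_cell (f s) (f s') (g t) (g t').
  have c1 (h : R -> point) : {within I, continuous h} -> {within I, continuous (fst \o h)}.
    move=> /(@subspace_continuousP _ I _ h) ch.
    apply/(@subspace_continuousP _ I) => x Ix.
    by apply: cvg_comp (ch x Ix) _; exact: cvg_fst.
  have c2 (h : R -> point) : {within I, continuous h} -> {within I, continuous (snd \o h)}.
    move=> /(@subspace_continuousP _ I _ h) ch.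
    apply/(@subspace_continuousP _ I) => x Ix.
    by apply: cvg_comp (ch x Ix) _; exact: cvg_snd.
  have [e1|n1] := eqVneq (f s0).1 (g t0).1.
    have n2 : (f s0).2 != (g t0).2.
      apply/eqP => e2; apply: (dfg s0 t0) => //.
      by rewrite [LHS]surjective_pairing e1 e2 -surjective_pairing.
    have [d d0 H] := same_sign_near Is0 It0 (c2 _ cf) (c2 _ cg) n2.
    by exists d => // *; apply/orP; right; apply: H.
  have [d d0 H] := same_sign_near Is0 It0 (c1 _ cf) (c1 _ cg) n1.
  by exists d => // *; apply/orP; left; apply: H.
(* One half of [d] is spent on reaching [x], the other on the mesh. *)
have hd : 0 < d / 2 by rewrite divr_gt0.
near=> x N => /= Ix1 Ix2 s' t' Is' It' ss tt.
have [b1 b2] : ball (s0, t0) (d / 2) x by near: x; apply: nbhsx_ballx.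
have Nd : N.+1%:R^-1 < d / 2 by near: N; exact: near_infty_natSinv_lt (PosNum hd).
have dd : d / 2 + d / 2 = d by rewrite -splitr.
apply: Hd => //.
- by rewrite (lt_trans b1)// ltr_pdivrMr// ltr_pMr// ltr1n.
- rewrite (le_lt_trans (ler_distD x.1 _ _))// -dd ltrD//; exact: le_lt_trans ss Nd.
- by rewrite (lt_trans b2)// ltr_pdivrMr// ltr_pMr// ltr1n.
- rewrite (le_lt_trans (ler_distD x.2 _ _))// -dd ltrD//; exact: le_lt_trans tt Nd.
Unshelve. all: by end_near.
Qed.

End Cells.

(** * From a plane drawing to short moves between sample points *)

Section Planar.
Variables (T : finType) (e : rel T).
Hypothesis Hplanar : planar e.
Local Notation R := Rdefinitions.R.
Local Notation point := (R * R)%type.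

Lemma planar_steps : exists (p : T -> point) (step : {set T} -> point -> point -> Prop),
  [/\ injective p,
    (forall A B : {set T}, [disjoint A & B] ->
       forall a a' b b', step A a a' -> step B b b' -> good_cell a a' b b'),
    (forall A B : {set T}, A \subset B -> forall u v, step A u v -> step B u v) &
    (forall (A : {set T}) x y, x \in A -> y \in A -> e x y ->
       exists L, chain (step A) (p x) L /\ last (p x) L = p y)].
Proof.
have [p [c [p_inj Hc]]] := Hplanar.
pose P x y z w N := e x y -> e z w -> [disjoint [set x; y] & [set z; w]] ->
  forall s s' t t' : R, (0 <= s <= 1 -> 0 <= s' <= 1 -> 0 <= t <= 1 -> 0 <= t' <= 1 ->
    `|s - s'| <= N.+1%:R^-1 -> `|t - t'| <= N.+1%:R^-1 ->
    good_cell (c x y s) (c x y s') (c z w t) (c z w t'))%R.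
(* There are finitely many pairs of edges, so one mesh serves them all. Pairs sharing an end are
   exempt, because their arcs do meet. *)
have [N HN] : exists N, forall x y z w, P x y z w N.
  have : (\forall N \near \oo, forall x y z w, P x y z w N)%classic.
    apply: filter_forall => x; apply: filter_forall => y.
    apply: filter_forall => z; apply: filter_forall => w.
    have [exy|nxy] := boolP (e x y); last by apply: nearW => N exy; rewrite exy in nxy.
    have [ezw|nzw] := boolP (e z w); last by apply: nearW => N _ ezw; rewrite ezw in nzw.
    have [dis|nd] := boolP [disjoint [set x; y] & [set z; w]];
      last by apply: nearW => N _ _ dis; rewrite dis in nd.
    have [c1 i1 [b1 b1'] v1 d1] := Hc _ _ exy; have [c2 i2 [b2 b2'] v2 d2] := Hc _ _ ezw.
    have xz : x != z.
      by apply: contraTneq dis => ->; rewrite -setI_eq0; apply/set0Pn; exists z; rewrite !inE eqxx.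
    have xw : x != w.
      by apply: contraTneq dis => ->; rewrite -setI_eq0; apply/set0Pn; exists w; rewrite !inE eqxx !orbT.
    have yz : y != z.
      by apply: contraTneq dis => ->; rewrite -setI_eq0; apply/set0Pn; exists z; rewrite !inE eqxx !orbT.
    have yw : y != w.
      by apply: contraTneq dis => ->; rewrite -setI_eq0; apply/set0Pn; exists w; rewrite !inE eqxx !orbT.
    have ends x' y' (exy' : e x' y') (t : R) : (0 <= t <= 1)%R ->
        [\/ (0 < t < 1)%R, c x' y' t = p x' | c x' y' t = p y'].
      have [_ _ [b b'] _ _] := Hc _ _ exy'.
      case/andP; rewrite !le_eqVlt => /orP[/eqP<-|t0]; first by rewrite b => _; apply: Or32.
      by case/orP => [/eqP->|t1]; [rewrite b' | rewrite t0 t1]; [apply: Or33 | apply: Or31].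
    (* Closed arcs of vertex-disjoint edges do not meet: interiors avoid each other and all
       vertices, and the four ends are distinct points. *)
    have dst s t : (0 <= s <= 1)%R -> (0 <= t <= 1)%R -> c x y s <> c z w t.
      move=> /(ends _ _ exy) Es /(ends _ _ ezw) Et.
      case: Es => [Is|->|->]; case: Et => [It|->|->].
      - apply: d1 => //; rewrite !negb_or !negb_and.
        by rewrite !(eq_sym z) xz yz.
      - by apply: v1.
      - by apply: v1.
      - by move=> E; apply: (v2 t x).
      - by move/p_inj/eqP; rewrite (negPf xz).
      - by move/p_inj/eqP; rewrite (negPf xw).
      - by move=> E; apply: (v2 t y).
      - by move/p_inj/eqP; rewrite (negPf yz).
      - by move/p_inj/eqP; rewrite (negPf yw).
    have := good_cells c1 c2 dst; apply: filterS => N H _ _ _ s s' t t'.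
    exact: H.
  by move/filter_ex => [N HN]; exists N.
pose tk k : R := (k%:R / N.+1%:R)%R.
have tk01 k : k <= N.+1 -> (0 <= tk k <= 1)%R.
  move=> kN; rewrite /tk divr_ge0 ?ler0n //= ler_pdivrMr ?ltr0n // mul1r ler_nat //.
have tkS k : (`|tk k - tk k.+1| <= N.+1%:R^-1)%R.
  by rewrite distrC /tk -mulrBl -natrB // subSnn mul1r ger0_norm // invr_ge0 ler0n.
pose step (A : {set T}) u v := exists x y k, [/\ x \in A, y \in A, e x y, k < N.+1 &
  u = c x y (tk k) /\ v = c x y (tk k.+1)].
exists p, step; split=> //.
- move=> A B dAB a a' b b' [x [y [k [xA yA exy kN [-> ->]]]]] [z [w [l [zB wB ezw lN [-> ->]]]]].
  apply: HN => //; rewrite ?tk01 //; try exact: ltnW.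
  by apply: disjointW dAB; apply/subsetP => v /set2P[]->.
- move=> A B AB u v [x [y [k [xA yA exy kN E]]]].
  by exists x, y, k; split=> //; apply: (subsetP AB).
- move=> A x y xA yA exy; have [_ _ [b b'] _ _] := Hc _ _ exy.
  have H k m : k + m = N.+1 -> exists L, chain (step A) (c x y (tk k)) L /\ last (c x y (tk k)) L = p y.
    elim: m k => [|m IH] k; rewrite ?addn0 ?addnS => E.
      by exists [::]; rewrite /= E /tk divff ?b' // pnatr_eq0.
    have [L [cL lL]] := IH k.+1 E; exists (c x y (tk k.+1) :: L); split=> //=; split=> //.
    by exists x, y, k; split=> //; rewrite -E; lia.
  by have := H 0 N.+1 erefl; rewrite /tk mul0r b.
Qed.

Section Obstructions.
Variables (p : T -> point) (step : {set T} -> point -> point -> Prop).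
Hypothesis p_inj : injective p.
Hypothesis step_good : forall A B : {set T}, [disjoint A & B] ->
  forall a a' b b', step A a a' -> step B b b' -> good_cell a a' b b'.
Hypothesis stepS : forall A B : {set T}, A \subset B -> forall u v, step A u v -> step B u v.
Hypothesis edge_chain : forall (A : {set T}) x y, x \in A -> y \in A -> e x y ->
  exists L, chain (step A) (p x) L /\ last (p x) L = p y.

Lemma conn_chain A x y : conn e A -> x \in A -> y \in A ->
  exists L, chain (step A) (p x) L /\ last (p x) L = p y.
Proof.
case/connP=> _ H xA yA; case/connectP: (H x y xA yA) => q; elim: q x xA => [|z q IH] x xA /=.
  by move=> _ ->; exists [::].
case/andP=> /and3P[_ zA exz] /(IH z zA) {}IH /IH[L [cL lL]].
have [L1 [c1 l1]] := edge_chain xA zA exz.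
by exists (L1 ++ L); rewrite last_cat l1; split=> //; apply: chain_cat => //; rewrite l1.
Qed.

Lemma linked_chain A B x y : conn e A -> conn e B -> linked e A B -> x \in A -> y \in B ->
  exists L, chain (step (A :|: B)) (p x) L /\ last (p x) L = p y.
Proof.
move=> cA cB /andP[_ /exists_inP[a aA /exists_inP[b bB eab]]] xA yB.
have [L1 [c1 l1]] := conn_chain cA xA aA.
have [L3 [c3 l3]] := conn_chain cB bB yB.
have [L2 [c2 l2]] : exists L, chain (step (A :|: B)) (p a) L /\ last (p a) L = p b.
  by apply: edge_chain; rewrite ?inE ?aA ?bB ?orbT.
exists (L1 ++ L2 ++ L3); rewrite !last_cat l1 l2; split=> //.
apply: chain_cat; first by apply: chain_sub c1 => u v; apply: stepS; apply: subsetUl.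
rewrite l1; apply: chain_cat => //; rewrite l2.
by apply: chain_sub c3 => u v; apply: stepS; apply: subsetUr.
Qed.

Lemma bags_drawing (n : nat) (edge : rel nat) (A : nat -> {set T}) :
  (forall i, i < n -> conn e (A i)) ->
  (forall i j, i < n -> j < n -> edge i j -> linked e (A i) (A j)) ->
  0 < n -> exists (a : nat -> T) (L : nat -> nat -> seq point),
  (forall i, i < n -> a i \in A i) /\
  (forall i j, i < n -> j < n -> edge i j -> chain (step (A i :|: A j)) (p (a i)) (L i j)
     /\ last (p (a i)) (L i j) = p (a j)).
Proof.
move=> cA lA n0.
have [x0 _] : exists x0, x0 \in A 0 by apply/set0Pn; case/connP: (cA 0 n0).
pose a i := odflt x0 [pick x in A i].
have aA i : i < n -> a i \in A i.
  move=> /cA/connP[/set0Pn[x xA] _]; rewrite /a; case: pickP => //= /(_ x); by rewrite xA.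
pose Q (ij : nat * nat) L := ij.1 < n -> ij.2 < n -> edge ij.1 ij.2 ->
  chain (step (A ij.1 :|: A ij.2)) (p (a ij.1)) L /\ last (p (a ij.1)) L = p (a ij.2).
suff /boolp.choice[L hL] : forall ij, exists L, Q ij L.
  by exists a, (fun i j => L (i, j)); split=> // i j; exact: (hL (i, j)).
move=> [i j]; rewrite /Q /=.
have [i5|] := boolP (i < n); last by exists [::].
have [j5|] := boolP (j < n); last by exists [::].
have [eij|] := boolP (edge i j); last by exists [::].
have [L hL] := linked_chain (cA i i5) (cA j j5) (lA i j i5 j5 eij) (aA i i5) (aA j j5).
by exists L.
Qed.

End Obstructions.

Theorem planar_K5_free : K5_free e.
Proof.
have [p [step [p_inj sg sS ec]]] := planar_steps.
move=> B sB cB; apply/negP => /(pairwiseP set0) lB.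
have lB' i j : i < 5 -> j < 5 -> i < j -> linked e (nth set0 B i) (nth set0 B j).
  by move=> i5 j5 ij; apply: lB; rewrite // inE sB.
have cB' i : i < 5 -> conn e (nth set0 B i) by move=> i5; apply: (allP cB); rewrite mem_nth // sB.
have [a [L [aA hL]]] := bags_drawing sS ec cB' lB' isT.
apply: (no_K5_drawing p_inj sg _ aA hL) => i j /andP[ij j5].
by case/andP: (lB' i j (ltn_trans ij j5) j5 ij).
Qed.

Theorem planar_K33_free : K33_free e.
Proof.
have [p [step [p_inj sg sS ec]]] := planar_steps.
move=> X Y sX sY cXY /(pairwiseP set0) dXY; apply/negP => /allrelP lXY.
have sXY : size (X ++ Y) = 6 by rewrite size_cat sX sY.
pose A := nth set0 (X ++ Y).
have cA i : i < 6 -> conn e (A i) by move=> i6; apply: (allP cXY); rewrite mem_nth // sXY.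
have dA i j : i < j < 6 -> [disjoint A i & A j].
  by case/andP=> ij j6; apply: dXY; rewrite // inE sXY //; apply: ltn_trans j6.
have lA i j : i < 6 -> j < 6 -> (i < 3) && (2 < j) -> linked e (A i) (A j).
  move=> i6 j6 /andP[i3 j2]; rewrite /A !nth_cat sX i3 ltnNge j2 /=.
  by apply: lXY; rewrite mem_nth ?sX ?sY // ltn_subLR.
have [a [L [aA hL]]] := bags_drawing sS ec cA lA isT.
exact: (no_K33_drawing p_inj sg dA aA hL).
Qed.

End Planar.

(** * Separating triangles *)

Section Split.
Variable T : finType.
Implicit Types (r : rel T) (C S t : {set T}) (F : {set {set T}}).

Definition clique r t := {in t &, forall u v, u != v -> r u v}.

(** A connected set outside [t] that misses a corner of [t] is attached to it along at most one
    edge. Quantifying over all connected sets, not only components, makes the property pass to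
    subgraphs. *)
Definition separating r S t := forall C, C \subset S -> conn r C -> [disjoint C & t] ->
  exists2 v, v \in t & forall c, c \in C -> ~~ r v c.

Lemma component_conn r C s : symmetric r -> s \in C ->
  conn r [set u | connect (restr r C) s u].
Proof.
move=> sr sC; set D := [set u | _].
have cs : connect_sym (restr r C) by apply: sym_connect_sym; apply: restr_sym.
have H u : u \in D -> connect (restr r D) s u.
  rewrite inE => /connectP[p]; elim/last_ind: p u => [|p w IH] u; first by move=> _ ->.
  rewrite rcons_path last_rcons => /andP[pp st] ->.
  have c1 : connect (restr r C) s (last s p) by apply/connectP; exists p.
  apply: connect_trans (IH _ pp erefl) (connect1 _).
  rewrite /restr !inE c1 (connect_trans c1 (connect1 st)) /=.
  by case/and3P: st.
have cs' : connect_sym (restr r D) by apply: sym_connect_sym; apply: restr_sym.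
apply/connP; split; first by apply/set0Pn; exists s; rewrite inE.
by move=> a b aD bD; apply: connect_trans (H b bD); rewrite cs' H.
Qed.

Lemma set2_of_card2 (A : {set T}) : #|A| = 2 -> exists x y, x != y /\ A = [set x; y].
Proof. by move/eqP/cards2P => [x [y [xy ->]]]; exists x, y. Qed.

(* The side C of a separating triangle t misses some b in t, so G is the union of
   C + (t - b) and G - C, which share one edge; each part obeys the bound 3n - 6. *)
Theorem separating_triangles_arcs r S F : symmetric r -> irreflexive r ->
  (forall u v, r u v -> u \in S) -> K5_free r -> 3 <= #|S| -> trivIset F ->
  (forall t, t \in F -> [/\ #|t| = 3, t \proper S, clique r t & separating r S t]) ->
  arcs r + 12 + 2 * #|F| <= 6 * #|S|.
Proof.
have [n] := ubnP #|F|; elim: n r S F => // n IH r S F hn sr ir rS fr S3 tF hF.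
have [->|/set0Pn[t tinF]] := eqVneq F set0.
  by rewrite cards0 muln0 addn0; apply: K5_free_arcs.
have [t3 /properP[tS [s sS st]] tcl tsep] := hF t tinF.
set C := [set u | connect (restr r (~: t)) s u].
have sC : s \in C by rewrite inE.
have Ct u : u \in C -> u \notin t.
  rewrite inE => /connectP[p]; elim/last_ind: p u => [|p w _] u; first by move=> _ ->.
  by rewrite rcons_path last_rcons => /andP[_ /and3P[_ + _]] ->; rewrite inE.
have CS : C \subset S.
  apply/subsetP => u; rewrite inE => /connectP[p]; elim/last_ind: p u => [|p w _] u; first by move=> _ ->.
  by rewrite rcons_path last_rcons => /andP[_ /and3P[_ _ rw]] ->; apply: (rS w (last s p)); rewrite sr.
have Cr u v : u \in C -> r u v -> v \in C \/ v \in t.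
  move=> uC ruv; have [|vt] := boolP (v \in t); first by right.
  left; move: (uC); rewrite !inE => /connect_trans; apply; apply: connect1.
  by rewrite /restr !inE Ct // vt.
have sCt : s \in ~: t by rewrite inE.
have dCt : [disjoint C & t] by rewrite disjoint_subset; apply/subsetP => u /Ct.
have cC : conn r C := component_conn sr sCt.
have [b bt bC] := tsep C CS cC dCt.
clearbody C.
have [x [a [xa tb]]] : exists x a, x != a /\ t :\ b = [set x; a].
  by apply: set2_of_card2; move: (cardsD1 b t); rewrite bt t3 => -[].
have xtb : x \in t :\ b by rewrite tb set21.
have atb : a \in t :\ b by rewrite tb set22.
have xt : x \in t by case/setD1P: xtb.
have at_ : a \in t by case/setD1P: atb.
set H1 := C :|: (t :\ b); set H2 := S :\: C.
have tH2 : t \subset H2.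
  by apply/subsetP => u ut; rewrite inE (subsetP tS) // andbT; apply/negP => /Ct; rewrite ut.
have cH1 : #|H1| = #|C| + 2.
  rewrite cardsU (_ : C :&: _ = set0) ?cards0 ?subn0; first by rewrite tb cards2 xa.
  by apply: disjoint_setI0; apply: disjointWr dCt; apply: subsetDl.
have cH2 : #|H2| + #|C| = #|S|.
  by rewrite addnC -(cardsID C S) (setIidPr CS).
have arcsE : arcs r + 2 <= arcs (restr r H1) + arcs (restr r H2).
  rewrite /arcs -cardsUI leq_add //.
    apply/subset_leq_card/subsetP => -[u v]; rewrite !inE /= /restr !inE.
    move=> ruv; rewrite ruv (rS _ _ ruv) (rS v u) ?andbT 1?sr //.
    have ub w z : r w z -> w \in C -> z != b.
      by move=> rwz wC; apply: contraTneq rwz => ->; rewrite sr bC.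
    have [uC|uC] := boolP (u \in C) => /=.
      by case: (Cr u v uC ruv) => -> //=; rewrite ?orbT // (ub _ _ ruv uC) orbT.
    have [vC|vC] /= := boolP (v \in C); last by rewrite orbT.
    have rvu : r v u by rewrite sr.
    by case: (Cr v u vC rvu) => [uC'|->]; [rewrite uC' in uC | rewrite (ub _ _ rvu vC)].
  have rxa : r x a by apply: tcl.
  apply: leq_trans (_ : #|[set (x, a); (a, x)]| <= _).
    by rewrite cards2 xpair_eqE (negPf xa).
  have xH1 : x \in H1 by rewrite inE xtb orbT.
  have aH1 : a \in H1 by rewrite inE atb orbT.
  have xH2 := subsetP tH2 x xt; have aH2 := subsetP tH2 a at_.
  apply/subset_leq_card/subsetP => -[u v] /set2P[][-> ->]; rewrite !inE /= /restr.
    by rewrite xH1 aH1 xH2 aH2 rxa.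
  by rewrite xH1 aH1 xH2 aH2 sr rxa.
have dis t' : t' \in F :\ t -> [disjoint t' & t].
  by case/setD1P => tt t'F; move/trivIsetP: tF; apply.
pose F1 := [set t' in F :\ t | t' \subset C].
pose F2 := [set t' in F :\ t | t' \subset H2].
(* Any other triangle of [F] is disjoint from [t], and a clique cannot have vertices on both sides
   of [t], so it survives whole in one part. *)
have cF : #|F| <= #|F1| + #|F2| + 1.
  rewrite (cardsD1 t F) tinF addnC leq_add2r.
  apply: leq_trans (leq_card_setU _ _); apply/subset_leq_card/subsetP => t' t'F.
  rewrite !inE -!in_setD1 t'F /=.
  have t'F0 : t' \in F by case/setD1P: t'F.
  have [_ /proper_sub t'S t'cl _] := hF t' t'F0.
  have [t'C|] := boolP [disjoint t' & C].
    apply/orP; right; apply/subsetP => u ut'; rewrite inE (subsetP t'S) // andbT.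
    by rewrite (disjointFr t'C).
  rewrite -setI_eq0 => /set0Pn[u /setIP[ut' uC]].
  apply/orP; left; apply/subsetP => v vt'; have [<-//|uv] := eqVneq u v.
  case: (Cr u v uC (t'cl u v ut' vt' uv)) => // vt.
  by move: (disjointFr (dis t' t'F) vt'); rewrite vt.
have part (H : {set T}) (F' : {set {set T}}) : 3 <= #|H| -> x \in H ->
    H \subset S -> F' \subset F :\ t -> (forall t', t' \in F' -> t' \subset H) ->
    arcs (restr r H) + 12 + 2 * #|F'| <= 6 * #|H|.
  move=> H3 xH HS F'F F'H; apply: IH => //.
  - apply: leq_ltn_trans (subset_leq_card F'F) _.
    by move: hn; rewrite (cardsD1 t F) tinF.
  - exact: restr_sym.
  - exact: restr_irr.
  - by move=> u v /and3P[].
  - exact: sub_K5_free (@restr_sub _ r _) fr.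
  - apply: trivIsetS tF; apply: subset_trans F'F _; exact: subsetDl.
  move=> t' t'F'; have t'Ft := subsetP F'F _ t'F'.
  have [c3 _ cl sep] := hF t' (subsetP (subsetDl _ _) _ t'Ft).
  split=> //.
  - rewrite properE F'H //=; apply/subsetPn; exists x => //.
    by rewrite (disjointFl (dis t' t'Ft)).
  - by move=> u v ut vt uv; rewrite /restr !(subsetP (F'H t' t'F')) // cl.
  move=> D DH cD dD; have [v vt vD] := sep D (subset_trans DH HS) (sub_conn (@restr_sub _ r _) cD) dD.
  by exists v => // c /vD; apply: contra => /and3P[].
have P1 : arcs (restr r H1) + 12 + 2 * #|F1| <= 6 * #|H1|.
  apply: part.
  - by rewrite cH1 addn2 !ltnS card_gt0; apply/set0Pn; exists s.
  - by rewrite inE xtb orbT.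
  - by rewrite subUset CS (subset_trans (subsetDl _ _)).
  - by apply/subsetP => t'; rewrite inE => /andP[].
  - by move=> t'; rewrite inE => /andP[_ t'C]; apply: subset_trans t'C (subsetUl _ _).
have P2 : arcs (restr r H2) + 12 + 2 * #|F2| <= 6 * #|H2|.
  apply: part.
  - by rewrite -t3; apply: subset_leq_card.
  - exact: (subsetP tH2).
  - exact: subsetDl.
  - by apply/subsetP => t'; rewrite inE => /andP[].
  - by move=> t'; rewrite inE => /andP[].
(* The parts share two vertices, which costs 12; the second constant 12 pays for that. The common
   edge, counted twice, leaves 2 arcs for [t]. *)
clearbody H1 H2 F1 F2; clear -arcsE cF P1 P2 cH1 cH2; lia.
Qed.

End Split.

(** * Discharging *)

Section Discharging.
Variables (T : finType) (e : rel T).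
Hypothesis e_sym : symmetric e.
Hypothesis e_irr : irreflexive e.
Hypothesis no_isolated : forall v : T, 0 < deg e v.
Hypothesis maxdeg : forall v : T, deg e v <= 8.

Local Notation d := (deg e).
Local Notation n8 := (n8 e).

Definition nbh v : {set T} := [set u | e v u].

Definition non8_nbh v : {set T} := [set u | e v u && (d u != 8)].

Definition good : {set T} := [set v | [forall u, ~~ reducible e v u]].

Definition V8 : {set T} := [set v | d v == 8].

Lemma degE v : d v = n8 v + #|non8_nbh v|.
Proof.
rewrite /deg /Defs.n8 /non8_nbh -(cardsID V8 [set u | e v u]).
by congr (_ + _); apply: eq_card => u; rewrite !inE // andbC.
Qed.

Lemma weakC x y : weak e x y = weak e y x.
Proof. by rewrite /weak orbC. Qed.

Lemma nonweakP x y : e x y -> ~~ weak e x y ->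
  8 + (d y == 8) < n8 x + d y /\ 8 + (d x == 8) < n8 y + d x.
Proof.
by rewrite /weak /x_weak => exy; rewrite (e_sym y x) exy /= negb_or -!ltnNge => /andP[].
Qed.

Lemma good_nonweak v u : v \in good -> e v u -> ~~ weak e v u.
Proof.
by rewrite inE => /forallP/(_ u); rewrite /reducible => + evu; rewrite evu negb_or => /andP[].
Qed.

Lemma good_not_butterfly v u : v \in good -> e v u -> ~~ butterfly_like e v u.
Proof.
by rewrite inE => /forallP/(_ u); rewrite /reducible => + evu; rewrite evu negb_or => /andP[].
Qed.

Lemma has_nbr v : exists u, e v u.
Proof. by have := no_isolated v; rewrite card_gt0 => /set0Pn[u]; rewrite inE; exists u. Qed.

Lemma n8_lt x y : e x y -> d y != 8 -> n8 x < d x.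
Proof.
move=> exy dy; rewrite degE -addn1 leq_add2l card_gt0.
by apply/set0Pn; exists y; rewrite inE exy.
Qed.

Lemma good_n8 v : v \in good -> 2 <= n8 v.
Proof.
move=> vg; have [u evu] := has_nbr v.
have [H _] := nonweakP evu (good_nonweak vg evu).
have := maxdeg u; move: H; clear; case: eqP; lia.
Qed.

(** For an 8-vertex with a non-weak edge to a k-vertex, k < 8, this allows at most k - 1 non-8
    neighbours: the source of the amounts 120 / (k - 1), whose total stays within the surplus 120 =
    60 * (8 - 6). *)
Lemma non8_nbh_bound x y : e x y -> ~~ weak e x y -> d y != 8 ->
  #|non8_nbh x| + 9 <= d x + d y.
Proof.
move=> exy nw dy; have [+ _] := nonweakP exy nw; rewrite (negPf dy) addn0 (degE x).
by clear; lia.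
Qed.

Lemma bad_card : #|~: good| <= 2 * #|reducible_edges e|.
Proof.
have H : ~: good \subset cover (reducible_edges e).
  apply/subsetP => v; rewrite !inE negb_forall => /existsP[u]; rewrite negbK => rvu.
  apply/bigcupP; exists [set v; u]; rewrite ?set21 // inE.
  by apply/existsP; exists v; apply/existsP; exists u; rewrite eqxx.
apply: leq_trans (subset_leq_card H) _; apply: leq_trans (leq_card_cover _) _.
rewrite mulnC -sum_nat_const; apply: leq_sum => E; rewrite inE => /existsP[x /existsP[y /andP[/eqP-> _]]].
by rewrite cards2; case: (x == y).
Qed.

(* Charges are multiplied by 60, so that an 8-vertex sends 120 / (k - 1) along a
   non-weak edge to a k-vertex, 2 <= k <= 7. *)
Definition amount (a b : nat) : nat :=
  match a, b with
  | 8, 2 => 120 | 8, 3 => 60 | 8, 4 => 40 | 8, 5 => 30 | 8, 6 => 24 | 8, 7 => 20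
  | 7, 3 => 60 | 7, 4 => 60 | 7, 5 => 30
  | 6, 4 => 60
  | _, _ => 0
  end.

Definition send x y := if e x y && ~~ weak e x y then amount (d x) (d y) else 0.
Definition sent x := \sum_y send x y.
Definition received y := \sum_x send x y.

Lemma sent_bound x m c : (forall y, e x y -> ~~ weak e x y -> d y != 8 -> amount (d x) (d y) * m <= c) ->
  sent x * m <= #|non8_nbh x| * c.
Proof.
move=> H; rewrite /sent big_distrl /= -sum_nat_const [leqRHS]big_mkcond /=.
apply: leq_sum => y _; rewrite /send inE.
case: (boolP (e x y)) => //= exy; case: (boolP (weak e x y)) => //= nw.
have [->|dy] := eqVneq (d y) 8; last exact: H.
by move: (d x); do 9?[case=> //].
Qed.

Lemma received_bound y (A : {set T}) m :
  (forall x, x \in A -> e y x /\ (~~ weak e y x -> m <= amount (d x) (d y))) ->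
  y \in good -> #|A| * m <= received y.
Proof.
move=> H yg; rewrite /received -sum_nat_const [leqLHS]big_mkcond /=.
apply: leq_sum => x _; case: ifP => // xA; have [eyx am] := H x xA.
by rewrite /send e_sym eyx weakC good_nonweak //= am // good_nonweak.
Qed.

Lemma received_n8 y : y \in good -> n8 y * amount 8 (d y) <= received y.
Proof.
by apply: received_bound => x; rewrite inE => /andP[eyx /eqP->].
Qed.

Lemma received_all y m : (forall x, e y x -> ~~ weak e y x -> m <= amount (d x) (d y)) ->
  y \in good -> d y * m <= received y.
Proof. by move=> H; apply: received_bound => x; rewrite inE => eyx; split=> // ; apply: H. Qed.

Lemma sent_le x c : (forall y, e x y -> ~~ weak e x y -> d y != 8 -> amount (d x) (d y) <= c) ->
  sent x <= #|non8_nbh x| * c.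
Proof. by move=> H; rewrite -[sent x]muln1; apply: sent_bound => y *; rewrite muln1 H. Qed.

Lemma sent8 x : d x = 8 -> sent x <= 120.
Proof.
move=> dx; have : sent x * #|non8_nbh x| <= #|non8_nbh x| * 120.
  apply: sent_bound => y exy nw dy; have := non8_nbh_bound exy nw dy; rewrite dx.
  move: (d y) (maxdeg y) dy (#|non8_nbh x|) => k; clear.
  by do 9?[case: k => [|k] //=]; move=> *; lia.
have [k0|] := posnP #|non8_nbh x|; last by move: (sent x) => s; clear; nia.
have : sent x <= #|non8_nbh x| * 120; last by rewrite k0; case: (sent x).
apply: sent_le => y _ _ _; rewrite dx.
by move: (d y); do 9?[case=> //].
Qed.

(** A good 7-vertex with k non-8 neighbours starts with 60 and receives at least 20 * (7 - k), where
    k is at most 5; the bound leaves it 40. *)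
Lemma sent7 x : d x = 7 -> sent x + 20 * minn #|non8_nbh x| 5 <= 160.
Proof.
move=> dx; set k := #|_|.
have H m c : m <= k -> (forall b, b <= 8 -> b != 8 -> m + 2 <= b -> amount 7 b <= c) -> sent x <= k * c.
  move=> mk Hc; apply: sent_le => y exy nw dy; rewrite dx; apply: Hc => //.
  by have := non8_nbh_bound exy nw dy; rewrite dx -/k; move: mk; clear; lia.
have := H 0 60; have := H 3 30; have := H 4 0; clear H; move: (sent x) k => s k {dx}.
have [k4 A _ _|k4 _] := leqP 4 k.
  have : s <= k * 0 by apply: A => // b; do 8?[case: b => [|b] //=].
  by clear -k4; lia.
have [k3 B _|k3 _ C] := leqP 3 k.
  have : s <= k * 30 by apply: B => // b; do 8?[case: b => [|b] //=].
  by clear -k4 k3; lia.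
have : s <= k * 60 by apply: C => // b; do 8?[case: b => [|b] //=].
by clear -k3; lia.
Qed.

Lemma sent6 x : d x = 6 -> sent x <= 60 /\ (2 <= #|non8_nbh x| -> sent x = 0).
Proof.
move=> dx; set k := #|_|.
have H m c : m <= k -> (forall b, b <= 8 -> b != 8 -> m + 3 <= b -> amount 6 b <= c) -> sent x <= k * c.
  move=> mk Hc; apply: sent_le => y exy nw dy; rewrite dx; apply: Hc => //.
  by have := non8_nbh_bound exy nw dy; rewrite dx -/k; move: mk; clear; lia.
have := H 0 60; have := H 2 0; clear H; move: (sent x) k => s k {dx} A B.
have {}A : 2 <= k -> s = 0.
  move=> k2; suff : s <= k * 0 by clear; lia.
  by apply: A => // b; do 8?[case: b => [|b] //=].
split=> //; have [/A->//|k1] := leqP 2 k.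
have : s <= k * 60 by apply: B => // b; do 8?[case: b => [|b] //=].
by clear -k1; lia.
Qed.

Lemma sent_small x : d x <= 5 -> sent x = 0.
Proof.
move=> dx; suff : sent x <= #|non8_nbh x| * 0 by clear; lia.
apply: sent_le => y _ _ _; move: (d x) dx (d y) => k; clear.
by do 6?[case: k => [|k] //=].
Qed.

(** The worst case behind 300 is a 1-vertex that receives nothing: 60 * (6 - 1). *)
Lemma final_charge v : 360 + sent v <= 60 * d v + received v + 300.
Proof.
have d0 := no_isolated v; have d8 := maxdeg v.
have [d5|] := leqP (d v) 5; first by rewrite sent_small //; clear -d0; lia.
rewrite leq_eqVlt => /orP[/eqP d6|].
  by have [+ _] := sent6 (esym d6); clear -d6; lia.
rewrite leq_eqVlt => /orP[/eqP d7|d9].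
  by have := sent7 (esym d7); clear -d7; lia.
have dv : d v = 8 by apply/eqP; rewrite eqn_leq d8.
by have := sent8 dv; clear -dv; lia.
Qed.

Lemma good_nbr v x : v \in good -> e v x -> d v != 8 ->
  9 <= n8 v + d x /\ 9 <= n8 x + d v /\ n8 x < d x.
Proof.
move=> vg evx dv; have nw := good_nonweak vg evx.
have [A B] := nonweakP evx nw; have C := @n8_lt x v; rewrite e_sym in C.
by have := C evx dv; move: A B; clear; lia.
Qed.

(** Good vertices of [mid] end with at least 30 to spare; those of [light8] send at most half of
    their surplus and keep at least 60. *)
Definition mid : {set T} := [set v in good | 3 < d v < 8].
Definition light8 : {set T} := [set v in good | (d v == 8) && (sent v <= 60)].

Lemma good_final_charge v : v \in good ->
  360 + sent v + 30 * (v \in mid) + 60 * (v \in light8) <= 60 * d v + received v.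
Proof.
move=> vg; rewrite [v \in mid]inE [v \in light8]inE vg /=; have d0 := no_isolated v; have d8 := maxdeg v.
have n2 := good_n8 vg; have dE := degE v.
have nb x := @good_nbr v x vg.
have [d1|] := leqP (d v) 1.
  have [x evx] := has_nbr v; have := nb x evx; have := maxdeg x.
  have -> : d v = 1 by apply/eqP; rewrite eqn_leq d1.
  by clear; lia.
have R8 := received_n8 vg.
rewrite leq_eqVlt => /orP[/eqP d2|].
  by rewrite sent_small -?d2 //; move: R8 n2; rewrite -d2 /=; clear; lia.
rewrite leq_eqVlt => /orP[/eqP d3|].
  rewrite sent_small -?d3 //=.
  have : d v * 60 <= received v; last by rewrite -d3; clear; lia.
  apply: received_all => // x evx _; have := nb x evx; have := maxdeg x.
  rewrite -d3; move: (d x) (n8 x) => k m; clear; do 9?[case: k => [|k] //=]; lia.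
rewrite leq_eqVlt => /orP[/eqP d4|].
  rewrite sent_small -?d4 //=.
  have : d v * 40 <= received v; last by rewrite -d4; clear; lia.
  apply: received_all => // x evx _; have := nb x evx; have := maxdeg x.
  rewrite -d4; move: (d x) (n8 x) => k m; clear; do 9?[case: k => [|k] //=]; lia.
rewrite leq_eqVlt => /orP[/eqP d5|].
  rewrite sent_small -?d5 //=.
  (* Three 8-neighbours send 90 = 60 + 30. With only two, every neighbour has degree at least 7 and
     sends 30. *)
  have [n3|n3] := leqP 3 (n8 v); first by move: R8 n3; rewrite -d5 /=; clear; lia.
  have : d v * 30 <= received v; last by rewrite -d5; clear; lia.
  apply: received_all => // x evx _; have := nb x evx; have := maxdeg x.
  rewrite -d5; move: n3 n2; move: (d x) (n8 x) (n8 v) => k m l; clear; do 9?[case: k => [|k] //=]; lia.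
rewrite leq_eqVlt => /orP[/eqP d6|].
  have [A B] := sent6 (esym d6); move: R8 dE n2 A B; rewrite -d6 /=.
  by move: (#|_|) (n8 v) => k l; clear; case: (leqP 2 k) => [k2 + + + _ /(_ isT)|k2 + + + + _]; lia.
rewrite leq_eqVlt => /orP[/eqP d7|d9].
  have := sent7 (esym d7); move: R8 dE n2; rewrite -d7 /=; clear; lia.
have dv : d v = 8 by apply/eqP; rewrite eqn_leq d8.
have := sent8 dv; rewrite dv /=; clear; lia.
Qed.

Lemma total_charge :
  360 * #|T| + 30 * #|mid| + 60 * #|light8| <= 60 * arcs e + 300 * #|~: good|.
Proof.
have E : \sum_v sent v = \sum_v received v by exact: exchange_big.
have H : \sum_v (360 + sent v + 30 * (v \in mid) + 60 * (v \in light8)) <=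
         \sum_v (60 * d v + received v + 300 * (v \in ~: good)).
  apply: leq_sum => v _; have [vg|vb] := boolP (v \in good).
    by rewrite in_setC vg muln0 addn0; apply: good_final_charge.
  rewrite in_setC [v \in mid]inE [v \in light8]inE (negPf vb) /= !muln0 !addn0 muln1.
  exact: final_charge.
have cnt c (A : {set T}) : \sum_v c * (v \in A) = c * #|A|.
  rewrite -sum1_card big_distrr [RHS]big_mkcond /=.
  by apply: eq_bigr => v _; case: (v \in A); rewrite ?muln0.
have sd : \sum_v 60 * d v = 60 * arcs e by rewrite -big_distrr /= arcs_sum.
have s360 : \sum_(v : T) 360 = 360 * #|T| by rewrite sum_nat_const mulnC.
have sum3 (f g h : T -> nat) : \sum_v (f v + g v + h v) = \sum_v f v + \sum_v g v + \sum_v h v.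
  by rewrite !big_split.
have sum4 (f g h k : T -> nat) :
    \sum_v (f v + g v + h v + k v) = \sum_v f v + \sum_v g v + \sum_v h v + \sum_v k v.
  by rewrite !big_split.
by move: H; rewrite (sum4 (fun=> 360)) sum3 !cnt sd s360 E; clear; lia.
Qed.

End Discharging.

(** * Counting *)

Lemma leq_card_rel (I J : finType) (A : {set I}) (B : {set J}) (R : I -> J -> bool) k :
  (forall a, a \in A -> exists2 b, b \in B & R a b) ->
  (forall b, b \in B -> #|[set a in A | R a b]| <= k) -> #|A| <= k * #|B|.
Proof.
move=> AB Bk; apply: leq_trans (_ : \sum_(b in B) #|[set a in A | R a b]| <= _); last first.
  by rewrite mulnC -sum_nat_const; apply: leq_sum.
rewrite -sum1_card (eq_bigr (fun b => \sum_(a in A) R a b)) => [|b bB]; last first.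
  rewrite -sum1_card big_mkcond [RHS]big_mkcond /=; apply: eq_bigr => a _.
  by rewrite inE; case: (a \in A); case: (R a b).
rewrite exchange_big /=; apply: leq_sum => a /AB[b bB Rab].
by rewrite (bigD1 b) //= Rab.
Qed.

Section Counting.
Variables (T : finType) (e : rel T).
Hypothesis e_sym : symmetric e.
Hypothesis e_irr : irreflexive e.
Hypothesis no_isolated : forall v : T, 0 < deg e v.
Hypothesis maxdeg : forall v : T, deg e v <= 8.
Hypothesis K5e : K5_free e.
Hypothesis K33e : K33_free e.

Local Notation d := (deg e).
Local Notation n8 := (n8 e).
Local Notation good := (good e).
Local Notation V8 := (V8 e).
Local Notation nbh := (nbh e).
Local Notation non8_nbh := (non8_nbh e).
Local Notation mid := (mid e).

Lemma good_nbr8 v : v \in good -> exists2 x, e v x & d x = 8.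
Proof.
move=> /(good_n8 e_sym no_isolated maxdeg) n2.
have /card_gt0P[x] : 0 < #|[set u | e v u && (d u == 8)]| by apply: ltn_trans n2.
by rewrite inE => /andP[evx /eqP dx]; exists x.
Qed.

(** Secures the hypothesis [3 <= #|S|] of the edge bound after vertices of low degree are
    deleted. *)
Lemma V8_ge3 v : v \in good -> 3 <= #|V8|.
Proof.
move=> vg; have [x evx dx] := good_nbr8 vg.
have [_] := nonweakP e_sym evx (good_nonweak vg evx).
have := maxdeg v => dv H; have n2 : 2 <= n8 x by move: H dv; clear; case: eqP; lia.
rewrite (cardsD1 x) inE dx eqxx ltnS; apply: leq_trans n2 _.
apply/subset_leq_card/subsetP => u; rewrite !inE => /andP[exu ->]; rewrite andbT.
by apply: contraTneq exu => ->; rewrite e_irr.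
Qed.

Lemma delete_arcs (Y : {set T}) k v : v \in good -> [disjoint V8 & Y] -> (forall y, y \in Y -> d y <= k) ->
  3 <= #|~: Y| /\ arcs e <= arcs (restr e (~: Y)) + 2 * (k * #|Y|).
Proof.
move=> vg dY Yk; split.
  apply: leq_trans (V8_ge3 vg) _; apply: subset_leq_card.
  by apply/subsetP => x x8; rewrite inE (disjointFr dY).
apply: leq_trans (arcs_delete Y e_sym) _; rewrite leq_add2l leq_mul2l /=.
by rewrite mulnC -sum_nat_const; apply: leq_sum.
Qed.

(** * Gains in the edge bound from vertices of degree 2 and 3 *)

Definition good2 : {set T} := [set v in good | d v == 2].
Definition good3 : {set T} := [set v in good | d v == 3].

(** Deleting a 2-vertex loses at most 4 arcs while the bound drops by 6. *)
Lemma good2_gain v : v \in good -> arcs e + 12 + 2 * #|good2| <= 6 * #|T|.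
Proof.
move=> vg; have [||S3 A] := @delete_arcs good2 2 v vg.
- rewrite -setI_eq0; apply/eqP/setP => x; rewrite !inE.
  by case: (d x =P 8) => //= ->; rewrite andbF.
- by move=> y; rewrite inE => /andP[_ /eqP->].
have := K5_free_arcs (restr_sym (~: good2) e_sym) (restr_irr _ e_irr) _
  (sub_K5_free (@restr_sub _ e _) K5e) S3.
move/(_ (fun u w H => proj1 (andP H))); have := cardsC good2; move: A; clear; lia.
Qed.

Definition open3 : {set T} := [set y in good3 | (nbh y \subset V8) &&
  ~~ [forall a in nbh y, forall b in nbh y, (a != b) ==> e a b]].

Lemma non8_nbh_good3 x y : y \in good3 -> e x y -> d x = 8 -> #|non8_nbh x| <= 2.
Proof.
rewrite inE => /andP[yg /eqP y3] exy dx.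
have nw : ~~ weak e x y by rewrite weakC good_nonweak // e_sym.
have := non8_nbh_bound e_sym exy nw; rewrite y3 dx => /(_ isT); clear; lia.
Qed.

Lemma good3_non8 x y : y \in good3 -> e x y -> y \in non8_nbh x.
Proof. by rewrite !inE => /andP[_ /eqP->] ->. Qed.

(** Removing a 3-vertex is neutral: 6 arcs against 6. The gain is the new edge between the two
    nonadjacent neighbours. All neighbours have degree 8, so no two contracted vertices are
    adjacent. An 8-vertex next to a good 3-vertex has at most two non-8 neighbours, so at most two
    contractions produce the same pair: hence the factor 2. *)
Lemma open3_gain v : v \in good ->
  exists2 p : nat, #|open3| <= 2 * p & arcs e + 12 + p <= 6 * #|T|.
Proof.
move=> vg.
pose P y (p : T * T) := [&& e y p.1, e y p.2, p.1 != p.2 & ~~ e p.1 p.2].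
pose f y := odflt (y, y) [pick p | P y p].
have fP y : y \in open3 -> P y (f y).
  rewrite inE => /and3P[_ _]; rewrite negb_forall_in => /exists_inP[a ya].
  rewrite negb_forall_in => /exists_inP[b yb]; rewrite negb_imply => /andP[ab eab].
  rewrite /f; case: pickP => //= /(_ (a, b)); rewrite /P /= ab eab.
  by move: ya yb; rewrite !inE => -> ->.
have o3 y : y \in open3 -> y \in good3 by rewrite inE => /andP[].
have o8 y x : y \in open3 -> e y x -> d x = 8.
  by rewrite inE => /and3P[_ /subsetP H _] eyx; apply/eqP; have := H x; rewrite !inE => ->.
have no8 y : y \in open3 -> d y != 8 by move=> /o3; rewrite inE => /andP[_ /eqP->].
have nbr_closed y x : y \in open3 -> e y x -> x \notin open3.
  by move=> yo /(o8 y x yo) dx; apply/negP => /no8; rewrite dx.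
pose phi v := if v \in open3 then (f v).1 else v.
have phiE u : u \notin open3 -> phi u = u by rewrite /phi => /negPf->.
have phi_out u : phi u \notin open3.
  rewrite /phi; case: ifP => [uo|->//]; have /and4P[e1 _ _ _] := fP u uo.
  exact: nbr_closed e1.
have phi_step u : phi u = u \/ e u (phi u).
  by rewrite /phi; case: ifP => [/fP/and4P[]|_]; [right|left].
have phi_idem u : phi (phi u) = phi u by apply: phiE.
set r := contract phi e.
have sr : symmetric r by apply: contract_sym.
have [||S3 A] := @delete_arcs open3 3 v vg.
- rewrite -setI_eq0; apply/eqP/setP => x; rewrite !in_setI in_set0.
  by case: (boolP (x \in open3)) => [/no8|]; rewrite ?andbF // inE => /negPf->.
- by move=> y /o3; rewrite inE => /andP[_ /eqP->].
have B : arcs r + 12 <= 6 * #|~: open3|.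
  apply: K5_free_arcs => //.
  - by move=> u; rewrite /r /contract eqxx.
  - by move=> u w /andP[_ /existsP[z /existsP[z' /and3P[/eqP<- _ _]]]]; rewrite inE.
  - exact: contract_K5_free.
exists #|f @: open3|.
  apply: (leq_card_rel (R := fun y p => f y == p)) => [y yo|p].
    by exists (f y) => //; apply: imset_f.
  case/imsetP=> y0 y0o ->; have /and4P[e1 _ _ _] := fP y0 y0o.
  apply: leq_trans (non8_nbh_good3 (o3 _ y0o) _ (o8 _ _ y0o e1)); last by rewrite e_sym.
  apply/subset_leq_card/subsetP => y; rewrite inE => /andP[yo /eqP fy].
  apply: good3_non8; first exact: o3.
  by rewrite -fy e_sym; case/and4P: (fP y yo).
have C : arcs (restr e (~: open3)) + #|f @: open3| <= arcs r.
  rewrite /arcs -cardsUI (_ : _ :&: _ = set0) ?cards0 ?addn0; last first.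
    apply/setP => p; rewrite !inE; apply/negbTE; rewrite negb_and -implybE.
    apply/implyP => /and3P[_ _ ep]; apply: contraTN ep => /imsetP[y yo ->].
    by case/and4P: (fP y yo).
  apply/subset_leq_card/subsetP => -[u w]; rewrite !inE => /orP[|].
    rewrite /restr !in_setC => /and3P[uo wo euw] /=; rewrite /r /contract.
    have -> : u != w by apply: contraTneq euw => ->; rewrite e_irr.
    by apply/existsP; exists u; apply/existsP; exists w; rewrite !phiE // !eqxx.
  case/imsetP=> y yo E; have /and4P[e1 e2 n12 _] := fP y yo.
  move: (e1) (e2) n12; rewrite -E /= => eyu eyw uw; rewrite /r /contract uw.
  apply/existsP; exists y; apply/existsP; exists w; rewrite eyw (phiE w) ?(nbr_closed y) //.
  by rewrite /phi yo -E !eqxx.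
have := cardsC open3; move: A B C; rewrite -/r; clear; lia.
Qed.

Definition twin3 : {set T} := [set y in good3 | [&& nbh y \subset V8,
  [forall a in nbh y, forall b in nbh y, (a != b) ==> e a b] &
  [exists z in good3, (z != y) && (nbh z == nbh y)]]].

Lemma twin3P y : y \in twin3 -> [/\ y \in good3, nbh y \subset V8, clique e (nbh y) &
  exists z, [/\ z \in twin3, z != y & nbh z = nbh y]].
Proof.
rewrite inE => /and4P[y3 y8 /forall_inP ycl /exists_inP[z z3 /andP[zy /eqP zN]]]; split=> //.
  by move=> a b aN bN ab; move/forall_inP/(_ b bN)/implyP: (ycl a aN); apply.
exists z; split=> //; rewrite inE z3 zN y8 /=; apply/andP; split; first exact/forall_inP.
by apply/exists_inP; exists y => //; rewrite eq_sym zy eqxx.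
Qed.

Lemma card_nbh3 y : y \in good3 -> #|nbh y| = 3.
Proof. by rewrite inE => /andP[_ /eqP]. Qed.

Lemma twin3_V8 : [disjoint V8 & twin3].
Proof.
rewrite -setI_eq0; apply/eqP/setP => x; rewrite !in_setI in_set0.
case: (boolP (x \in twin3)); rewrite ?andbF // => /twin3P[+ _ _ _].
by rewrite !inE => /andP[_ /eqP->].
Qed.

(** Otherwise the three vertices of the triangle on one side and [y], its twin [z] and [C] on the
    other form a K33 minor. It lives in [e], where the deleted twins are still present. *)
Lemma twin3_separating y : y \in twin3 ->
  separating (restr e (~: twin3)) (~: twin3) (nbh y).
Proof.
move=> yt C CS cC dC; set r := restr e _.
have [y3 y8 ycl [z [zt zy zN]]] := twin3P yt.
suff /exists_inP[v vt /forall_inP H] : [exists v in nbh y, [forall c in C, ~~ r v c]].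
  by exists v.
apply: contraT; rewrite negb_exists_in => /forall_inP H.
have {}H v : v \in nbh y -> exists2 c, c \in C & e v c.
  move/H; rewrite negb_forall_in => /exists_inP[c cC0]; rewrite negbK => /and3P[_ _ evc].
  by exists c.
have out w : w \in twin3 -> w \notin C.
  by move=> wt; apply/negP => /(subsetP CS); rewrite inE wt.
have Nout w v : w \in twin3 -> v \in nbh y -> v != w.
  move=> wt vN; apply: contraTneq wt => <-.
  by rewrite (disjointFr twin3_V8) // (subsetP y8).
have Ny v : v \in nbh y -> e v y by rewrite inE e_sym.
have Nz v : v \in nbh y -> e v z by rewrite -zN inE e_sym.
case E: (enum (nbh y)) (card_nbh3 y3) => [|a [|b [|c [|f N]]]]; rewrite cardE E //= => _.
have mN v : (v \in nbh y) = (v \in [:: a; b; c]) by rewrite -E mem_enum.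
have UN : uniq [:: a; b; c] by rewrite -E enum_uniq.
have aN : a \in nbh y by rewrite mN !inE eqxx.
have bN : b \in nbh y by rewrite mN !inE eqxx orbT.
have cN : c \in nbh y by rewrite mN !inE eqxx !orbT.
have l1 v : v \in nbh y -> linked e [set v] C.
  move=> vN; apply: linked1; first by rewrite (disjointFl dC).
  by have [u uC evu] := H v vN; apply/exists_inP; exists u.
have := K33e (X := [:: [set a]; [set b]; [set c]]) (Y := [:: [set y]; [set z]; C]) erefl erefl.
rewrite /= !conn1 (sub_conn (@restr_sub _ e _) cC) /= !andbT.
move: UN; rewrite /= !inE negb_or !andbT => /andP[/andP[ab ac] bc].
rewrite !disjoints1 !inE ab ac bc !(Nout _ a) // !(Nout _ b) // !(Nout _ c) //
  !(disjointFl dC aN, disjointFl dC bN, disjointFl dC cN) (negPf (out _ yt)) (negPf (out _ zt)).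
rewrite [y == z]eq_sym zy => /(_ isT isT)/negP[].
by rewrite /allrel /= !l1 // !linked11 ?Nout ?Ny ?Nz.
Qed.

(** A common vertex of two triangles would have three non-8 neighbours [y1], [z1], [y2], but next to
    a good 3-vertex it has at most two. *)
Lemma twin3_trivIset : trivIset (nbh @: twin3).
Proof.
apply/trivIsetP => _ _ /imsetP[y1 yt1 ->] /imsetP[y2 yt2 ->] neq.
rewrite -setI_eq0; apply: contraT => /set0Pn[x /setIP[x1 x2]].
have [y13 y18 _ [z1 [zt1 zy1 zN1]]] := twin3P yt1; have [y23 _ _ _] := twin3P yt2.
have [z13 _ _ _] := twin3P zt1.
have dx : d x = 8 by have := subsetP y18 x x1; rewrite inE => /eqP.
have ex1 : e x y1 by move: x1; rewrite inE e_sym.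
have ex2 : e x y2 by move: x2; rewrite inE e_sym.
have ez1 : e x z1 by move: x1; rewrite -zN1 inE e_sym.
have /subset_leq_card : [set y1; z1; y2] \subset non8_nbh x.
  by apply/subsetP => u; rewrite !in_setU !in_set1 => /orP[/orP[]|] /eqP->; apply: good3_non8.
have := non8_nbh_good3 y13 ex1 dx => A B; have := leq_trans B A.
have y21 : y2 != y1 by apply: contraNneq neq => ->.
have y2z : y2 != z1 by apply: contraNneq neq => ->; rewrite zN1.
by rewrite setUC cardsU1 !inE negb_or y21 y2z cards2 eq_sym zy1.
Qed.

Lemma twin3_gain v : v \in good -> arcs e + 12 + 2 * #|nbh @: twin3| <= 6 * #|T|.
Proof.
move=> vg; have [|S3 A] := @delete_arcs twin3 3 v vg twin3_V8.
  by move=> y /twin3P[/card_nbh3 + _ _ _]; rewrite /Defs.deg => ->.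
have V8S : V8 \subset ~: twin3.
  by apply/subsetP => x x8; rewrite inE (disjointFr twin3_V8).
suff H t : t \in nbh @: twin3 -> [/\ #|t| = 3, t \proper ~: twin3,
    clique (restr e (~: twin3)) t & separating (restr e (~: twin3)) (~: twin3) t].
  have B : arcs (restr e (~: twin3)) + 12 + 2 * #|nbh @: twin3| <= 6 * #|~: twin3|.
    exact: (separating_triangles_arcs (restr_sym _ e_sym) (restr_irr _ e_irr)
      (fun u w H => proj1 (andP H)) (sub_K5_free (@restr_sub _ e _) K5e) S3 twin3_trivIset H).
  by have := cardsC twin3; move: A B; clear; lia.
case/imsetP=> y yt ->; have [y3 y8 ycl _] := twin3P yt.
split; [exact: card_nbh3 | | | exact: twin3_separating].
  rewrite properEcard (subset_trans y8) //= card_nbh3 //.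
  apply: leq_trans (subset_leq_card V8S).
  (* Properness needs a fourth vertex in [V8]; an 8-neighbour of [y] has at least six
     8-neighbours. *)
  have [yg /eqP dy] : y \in good /\ d y == 3 by move: y3; rewrite inE => /andP.
  have [x eyx dx] := good_nbr8 yg.
  have [_] := nonweakP e_sym eyx (good_nonweak yg eyx); rewrite dy => n8x.
  apply: leq_trans (_ : n8 x <= _); first by move: n8x; clear; lia.
  by apply/subset_leq_card/subsetP => u; rewrite !inE => /andP[].
by move=> a b aN bN ab; rewrite /restr ycl // !(subsetP V8S) ?(subsetP y8).
Qed.

(** * Counting all vertices by the bad ones *)

Definition mixed3 : {set T} := [set y in good3 | ~~ (nbh y \subset V8)].

Lemma card_nbh_cover (A B : {set T}) k : (forall a, a \in A -> exists2 b, b \in B & e a b) ->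
  (forall b, b \in B -> d b <= k) -> #|A| <= k * #|B|.
Proof.
move=> AB Bk; apply: (leq_card_rel AB) => b /Bk; apply: leq_trans.
by apply/subset_leq_card/subsetP => a; rewrite !inE e_sym => /andP[].
Qed.

Lemma low_count : #|good2 :|: good3| <= 2 * #|V8|.
Proof.
have dlow y : y \in good2 :|: good3 -> y \in good /\ d y <= 3.
  by rewrite !in_setU ![_ \in [set _ in _ | _]]inE => /orP[]/andP[-> /eqP->].
apply: (leq_card_rel (R := e)) => [y /dlow[yg _]|x].
  by have [x eyx dx] := good_nbr8 yg; exists x => //; rewrite inE dx.
rewrite inE => /eqP dx.
have [->|/set0Pn[y]] := eqVneq [set a in good2 :|: good3 | e a x] set0; first by rewrite cards0.
rewrite inE => /andP[/dlow[yg dy] eyx].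
have nw : ~~ weak e x y by rewrite weakC good_nonweak.
have exy : e x y by rewrite e_sym.
have dy8 : d y != 8 by apply: contraTneq dy => ->.
have := non8_nbh_bound e_sym exy nw dy8; rewrite dx => B.
apply: leq_trans (_ : #|non8_nbh x| <= 2); last by move: B dy; clear; lia.
apply/subset_leq_card/subsetP => u; rewrite inE => /andP[/dlow[_ du] eux].
by rewrite inE e_sym eux; apply: contraTneq du => ->.
Qed.

(** A non-8 neighbour [u] of a good 3-vertex has degree at most 7, so non-weakness leaves it a
    single non-8 neighbour; sending each vertex to such a [u] is therefore injective. *)
Lemma mixed3_count : #|mixed3| <= #|mid| + #|~: good|.
Proof.
apply: leq_trans (leq_card_setU _ _); rewrite -[leqRHS]mul1n.
have nbr y u : y \in good3 -> e y u -> d u != 8 -> #|non8_nbh u| <= 1.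
  rewrite inE => /andP[yg /eqP dy] eyu du.
  have nw : ~~ weak e u y by rewrite weakC good_nonweak.
  have euy : e u y by rewrite e_sym.
  have := non8_nbh_bound e_sym euy nw; rewrite dy => /(_ isT).
  by move: (maxdeg u) du; clear; lia.
apply: (leq_card_rel (R := fun y u => e y u && (d u != 8))) => [y|u _].
  rewrite inE => /andP[y3 /subsetPn[u]]; rewrite !inE => eyu du; exists u; last by rewrite eyu.
  have [yg /eqP dy] : y \in good /\ d y == 3 by move: y3; rewrite inE => /andP.
  have := good_nbr e_sym yg eyu; rewrite dy => /(_ isT)[H _].
  have n3 := degE e y.
  rewrite in_setU in_setC; case: (boolP (u \in good)) => ug; rewrite ?orbT // orbF.
  by rewrite inE ug; move: H n3 (maxdeg u) du; rewrite dy; clear; lia.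
have [->|/set0Pn[y]] := eqVneq [set a in mixed3 | e a u && (d u != 8)] set0.
  by rewrite cards0.
rewrite inE => /andP[yc /andP[eyu du]].
have y3 : y \in good3 by move: yc; rewrite inE => /andP[].
apply: leq_trans (nbr y u y3 eyu du); apply/subset_leq_card/subsetP => z.
rewrite inE => /andP[zc /andP[ezu _]]; apply: good3_non8; last by rewrite e_sym.
by move: zc; rewrite inE => /andP[].
Qed.

(** Besides [x], each neighbourhood consists of two vertices. These two pairs differ: one common
    vertex gives the first form of butterfly, none gives the second. *)
Lemma butterfly_of_triangles x y z : e x y -> e x z -> y != z -> d x = 8 ->
  y \in good3 -> z \in good3 -> nbh y \subset V8 -> nbh z \subset V8 ->
  clique e (nbh y) -> clique e (nbh z) -> nbh y != nbh z -> butterfly_like e x y.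
Proof.
move=> exy exz yz dx y3 z3 y8 z8 ycl zcl yNz.
have xy : x \in nbh y by rewrite inE e_sym.
have xz : x \in nbh z by rewrite inE e_sym.
have [a [b [ab Ey]]] : exists a b, a != b /\ nbh y :\ x = [set a; b].
  by apply: set2_of_card2; move: (cardsD1 x (nbh y)); rewrite xy card_nbh3 // => -[].
have [a' [b' [ab' Ez]]] : exists a b, a != b /\ nbh z :\ x = [set a; b].
  by apply: set2_of_card2; move: (cardsD1 x (nbh z)); rewrite xz card_nbh3 // => -[].
have dy : d y = 3 by exact: card_nbh3.
have dz : d z = 3 by exact: card_nbh3.
have Py v : v \in nbh y :\ x -> [/\ x != v, e y v, e x v & d v = 8].
  case/setD1P=> vx vN; split; rewrite 1?eq_sym //; first by move: vN; rewrite inE.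
    by apply: ycl; rewrite // eq_sym.
  by have := subsetP y8 v vN; rewrite inE => /eqP.
have Pz v : v \in nbh z :\ x -> [/\ x != v, e z v, e x v & d v = 8].
  case/setD1P=> vx vN; split; rewrite 1?eq_sym //; first by move: vN; rewrite inE.
    by apply: zcl; rewrite // eq_sym.
  by have := subsetP z8 v vN; rewrite inE => /eqP.
have neq3 u v : d u = 3 -> d v = 8 -> u != v by move=> du; apply: contra_eqN => /eqP<-; rewrite du.
have xy' : x != y by rewrite eq_sym neq3.
have xz' : x != z by rewrite eq_sym neq3.
have B1 v1 v2 v3 : v1 \in nbh y :\ x -> v3 \in nbh y :\ x -> v1 \in nbh z :\ x ->
    v2 \in nbh z :\ x -> v1 != v2 -> v1 != v3 -> v2 != v3 -> butterfly_like e x y.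
  move=> /Py[x1 ey1 ex1 d1] /Py[x3 ey3 ex3 d3] /Pz[_ ez1 _ _] /Pz[x2 ez2 ex2 d2] n12 n13 n23.
  rewrite /butterfly_like; apply/orP; left; apply/existsP; exists z.
  apply/existsP; exists v1; apply/existsP; exists v2; apply/existsP; exists v3.
  rewrite exy exz ey1 ey3 ez1 ez2 ex1 ex2 ex3 dy dz dx d1 d2 d3 !eqxx !andbT /= !inE !negb_or.
  by rewrite xy' xz' x1 x2 x3 yz !(neq3 y) // !(neq3 z) // n12 n13 n23.
have a1 : a \in nbh y :\ x by rewrite Ey set21.
have b1 : b \in nbh y :\ x by rewrite Ey set22.
have a1' : a' \in nbh z :\ x by rewrite Ez set21.
have b1' : b' \in nbh z :\ x by rewrite Ez set22.
have neqN : [set a; b] != [set a'; b'].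
  by apply: contraNneq yNz => E; rewrite -(setD1K xy) -(setD1K xz) Ey Ez E.
have [E|aa] := eqVneq a a'.
  subst a'; apply: (B1 a b' b) => //.
  by apply: contraNneq neqN => ->.
have [E|ab2] := eqVneq a b'.
  subst b'; apply: (B1 a a' b) => //.
  by apply: contraNneq neqN => ->; rewrite setUC.
have [E|ba] := eqVneq b a'.
  by subst a'; apply: (B1 b b' a); rewrite // eq_sym.
have [E|bb] := eqVneq b b'.
  by subst b'; apply: (B1 b a' a); rewrite // eq_sym.
have [xa eya exa da] := Py a a1; have [xb eyb exb db] := Py b b1.
have [xa' eza exa' da'] := Pz a' a1'; have [xb' ezb exb' db'] := Pz b' b1'.
rewrite /butterfly_like; apply/orP; right; apply/orP; left; apply/existsP; exists z.
apply/existsP; exists a; apply/existsP; exists a'; apply/existsP; exists b'; apply/existsP; exists b.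
rewrite exy exz eya eyb eza ezb exa exb exa' exb' dy dz dx da db da' db' !eqxx !andbT /= !inE !negb_or.
by rewrite xy' xz' xa xb xa' xb' yz !(neq3 y) // !(neq3 z) // ab aa ab2 ab' (eq_sym a') ba (eq_sym b') bb.
Qed.

Lemma heavy8_nbr x : x \in good -> d x = 8 -> 60 < sent e x ->
  (exists2 u, u \in ~: good :|: good2 :|: mid :|: (open3 :|: mixed3) & e x u) \/
  x \in cover (nbh @: twin3).
Proof.
move=> xg dx sx; set A := _ :|: _.
have [/exists_inP|] := boolP [exists u in A, e x u]; first by left.
rewrite negb_exists_in => /forall_inP nA; right.
have ng u : e x u -> u \notin A by move=> exu; apply: contraL exu; exact: nA.
have non8_nbr_good3 y : y \in non8_nbh x -> [/\ y \in good3, e x y, nbh y \subset V8 & clique e (nbh y)].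
  rewrite inE => /andP[exy dy]; have := ng y exy.
  rewrite !in_setU !negb_or in_setC negbK => /andP[/andP[/andP[yg y2] ym] /andP[yo yc]].
  have y3 : y \in good3.
    move: y2 ym; rewrite [y \in good2]inE [y \in mid]inE [_ \in good3]inE yg /= => y2 ym.
    have := good_n8 e_sym no_isolated maxdeg yg; have := degE e y; have := maxdeg y.
    by move: y2 ym dy; clear; lia.
  have y8 : nbh y \subset V8 by move: yc; rewrite inE y3 /= negbK.
  split=> //; move: yo; rewrite inE y3 y8 /= negbK => /forall_inP ycl a b aN bN ab.
  by move/forall_inP/(_ b bN)/implyP: (ycl a aN); apply.
(* Only 3-vertices receive from [x], at most 60 each, so sending more than 60 takes two of them. *)
have /card_gt1P[y [z [yx zx yz]]] : 1 < #|non8_nbh x|.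
  have S : sent e x <= #|non8_nbh x| * 60.
    apply: sent_le => y exy _ dy; have [|y3 _ _ _] := non8_nbr_good3 y; first by rewrite inE exy.
    by rewrite dx (card_nbh3 y3 : d y = 3).
  by move: S sx; clear; lia.
have [y3 exy y8 ycl] := non8_nbr_good3 y yx; have [z3 exz z8 zcl] := non8_nbr_good3 z zx.
have [E|neq] := eqVneq (nbh y) (nbh z); last first.
  by have := good_not_butterfly xg exy; rewrite (butterfly_of_triangles exy exz yz).
apply/bigcupP; exists (nbh y); last by rewrite inE e_sym.
apply: imset_f; rewrite inE y3 y8 /=; apply/andP; split.
  by apply/forall_inP => a aN; apply/forall_inP => b bN; apply/implyP => ab; exact: ycl.
by apply/exists_inP; exists z => //; rewrite eq_sym yz E eqxx.
Qed.

Lemma card_le_bad : #|T| <= 730 * #|~: good|.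
Proof.
have [->|/set0Pn[v vg]] := eqVneq good set0.
  by rewrite setC0 cardsT leq_pmull.
have P := total_charge e_sym no_isolated maxdeg.
have G2 := good2_gain vg; have [p op Gp] := open3_gain vg; have Gt := twin3_gain vg.
set b := #|~: good| in P *.
pose G8 := [set x in good | d x == 8].
have low := low_count; have off := mixed3_count.
have cV8 : #|V8| <= #|G8| + b.
  apply: leq_trans (leq_card_setU _ _); apply/subset_leq_card/subsetP => x.
  by rewrite in_setU in_setC [x \in V8]inE [x \in G8]inE => ->; case: (x \in good).
have cT : #|T| <= b + #|good2 :|: good3| + #|mid| + #|G8|.
  rewrite -cardsT; apply: leq_trans (_ : #|~: good :|: (good2 :|: good3) :|: mid :|: G8| <= _).
    apply/subset_leq_card/subsetP => x _; rewrite !in_setU in_setC.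
    have [xg|//] := boolP (x \in good); rewrite [x \in good2]inE [x \in good3]inE
      [x \in mid]inE [x \in G8]inE xg /=.
    have := good_n8 e_sym no_isolated maxdeg xg; have := degE e x; have := maxdeg x.
    by clear; lia.
  do 3![apply: leq_trans (leq_card_setU _ _) _; rewrite ?leq_add2r //].
(* The factors 8, 2 and 3 bound the number of neighbours of a vertex in each class by its degree;
   the last 3 is the size of a triangle. *)
have cG8 : #|G8| <= #|light8 e| + 8 * (b + #|mid|) + 2 * #|good2| +
    3 * (#|open3| + #|mixed3|) + 3 * #|nbh @: twin3|.
  pose H := fun A : {set T} => [set x | [exists u in A, e x u]].
  have cH (A : {set T}) k : (forall u, u \in A -> d u <= k) -> #|H A| <= k * #|A|.
    by move=> Ak; apply: card_nbh_cover Ak => x; rewrite inE => /exists_inP.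
  have H3 y : y \in open3 :|: mixed3 -> d y <= 3.
    by rewrite in_setU => /orP[]; rewrite inE => /andP[/card_nbh3 + _]; rewrite /Defs.deg => ->.
  have H2 y : y \in good2 -> d y <= 2 by rewrite inE => /andP[_ /eqP->].
  have c1 := cH (~: good :|: mid) 8 (fun u _ => maxdeg u).
  have c2 := cH _ _ H2; have c3 := cH _ _ H3.
  have {}c1 := leq_trans c1 (leq_mul (leqnn 8) (leq_card_setU _ _)).
  have {}c3 := leq_trans c3 (leq_mul (leqnn 3) (leq_card_setU _ _)).
  have c4 : #|cover (nbh @: twin3)| <= 3 * #|nbh @: twin3|.
    apply: leq_trans (leq_card_cover _) _; rewrite mulnC -sum_nat_const.
    by apply: leq_sum => _ /imsetP[y /twin3P[y3 _ _ _] ->]; rewrite card_nbh3.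
  apply: leq_trans (_ : #|light8 e :|: H (~: good :|: mid) :|: H good2 :|:
     H (open3 :|: mixed3) :|: cover (nbh @: twin3)| <= _); last first.
    by do 4![apply: leq_trans (leq_card_setU _ _) (leq_add _ _) => //].
  apply/subset_leq_card/subsetP => x; rewrite inE => /andP[xg /eqP dx].
  rewrite !in_setU [x \in light8 e]inE xg dx eqxx /=.
  have [//|heavy] := leqP (sent e x) 60.
  case: (heavy8_nbr xg dx heavy) => [[u + exu]|->]; last by rewrite !orbT.
  have Hx (A : {set T}) : u \in A -> x \in H A.
    by move=> uA; rewrite inE; apply/exists_inP; exists u.
  rewrite -orbA in_setU => /orP[/setUP[/setUP[ub|/Hx->]|um]|/Hx->]; rewrite ?orbT //.
    by rewrite (Hx (~: good :|: mid)) // in_setU ub.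
  by rewrite (Hx (~: good :|: mid)) // in_setU um orbT.
(* Each gain, combined with [P], must fit together with 30 per vertex of [mid] and 60 per vertex of
   [light8] into a budget of 300 per bad vertex. The worst case spends it all on [mid] and gives a
   factor 376, below 730. *)
move: P G2 op Gp Gt low off cV8 cT cG8; clear; lia.
Qed.

End Counting.

Theorem theorem2 (T : finType) (e : rel T)
  (e_sym : symmetric e) (e_irr : irreflexive e)
  (no_isolated : forall v : T, (0 < deg e v)%N)
  (maxdeg : forall v : T, (deg e v <= 8)%N)
  (Hplanar : planar e) :
  (#|T| <= 1460 * #|reducible_edges e|)%N.
Proof.
have K5e := planar_K5_free Hplanar; have K33e := planar_K33_free Hplanar.
apply: leq_trans (card_le_bad e_sym e_irr no_isolated maxdeg K5e K33e) _.
by apply: leq_trans (leq_mul (leqnn 730) (bad_card e)) _; rewrite mulnA.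
Qed.
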